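(* Let $\mathbb{F}$ be a field of characteristic $0$ and let $\mathcal B$ be the Lie algebra over $\mathbb{F}$ with basis $\{L_{i,j},C\mid i,j\in\mathbb{Z}\}$ and brackets $$[L_{i,j},L_{k,l}]=((j+1)k-i(l+1))L_{i+k,j+l}+i\,\delta_{i,-k}\delta_{j+l,-2}C,\qquad [C,L_{i,j}]=0 .$$ Let $V$ be an irreducible highest weight $\mathcal B$-module of weight $\Lambda\in\mathcal B_0^*$. Then the following statements are equivalent: (1) $V$ is quasifinite; (2) $V$ is a proper quotient of the Verma module $M(\Lambda)$, i.e. $V\cong M(\Lambda)/N$ for some nonzero submodule $N$ of $M(\Lambda)$; (3) for every $j\in\mathbb{Z}$ the series $\Sigma_\Lambda^{(j)}(z):=z\Delta_\Lambda^{(-j)}(z)-j\Delta_\Lambda^{(-j-1)}(z)-\frac{c}{j!}z^j$ is a quasipolynomial, and there is one nontrivial linear differential equation with constant coefficients that is satisfied by $\Sigma_\Lambda^{(j)}(z)$ for all $j\in\mathbb{Z}$.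
   Context: $\mathcal B$ is $\mathbb{Z}$-graded: $\mathcal B=\bigoplus_{\alpha\in\mathbb{Z}}\mathcal B_\alpha$ with $\mathcal B_\alpha=\mathrm{span}\{L_{\alpha,i}\mid i\in\mathbb{Z}\}+\delta_{\alpha,0}\mathbb{F}C$; set $\mathcal B_\pm=\bigoplus_{\pm\alpha>0}\mathcal B_\alpha$. A weight is a linear functional $\Lambda\in\mathcal B_0^*$; its central charge is $c=\Lambda(C)$ and its labels are $\Lambda_i=\Lambda(L_{0,i-1})$, $i\in\mathbb{Z}$. For $j\in\mathbb{Z}$, the $j$-th generating series is $\Delta_\Lambda^{(j)}(z)=\sum_{i=0}^\infty\frac{\Lambda_{i+j}}{i!}z^i$. In $\Sigma_\Lambda^{(j)}$, the term $\frac{z^j}{j!}$ is understood to be $0$ when $j<0$. A quasipolynomial is a finite linear combination of functions $p(z)e^{az}$ with $p\in\mathbb{F}[z]$, $a\in\mathbb{F}$ (equivalently, a formal power series satisfying a nontrivial linear differential equation with constant coefficients). The Verma module $M(\Lambda)=U(\mathcal B)/I(\Lambda)$, where $I(\Lambda)$ is the left ideal of the universal enveloping algebra $U(\mathcal B)$ generated by all $L_{\alpha,i}$ with $\alpha>0$, $i\in\mathbb{Z}$, and all $h-\Lambda(h)\cdot1$ with $h\in\mathcal B_0$; $v_\Lambda$ denotes the image of $1$. A highest weight module of weight $\Lambda$ is a module generated by a vector $v$ with $\mathcal B_+v=0$ and $hv=\Lambda(h)v$ for $h\in\mathcal B_0$. A $\mathcal B$-module $V$ is quasifinite if $V=\bigoplus_{\alpha\in\mathbb{Z}}V_\alpha$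 with $\mathcal B_\alpha V_\beta\subset V_{\alpha+\beta}$ and $\dim V_\alpha<\infty$ for all $\alpha,\beta$. *)

(* Defs.v *)
From HB Require Import structures.
From mathcomp Require Import all_boot all_order all_algebra.
Set Implicit Arguments. Unset Strict Implicit. Unset Printing Implicit Defensive.
Import Order.TTheory GRing.Theory Num.Theory.
Local Open Scope ring_scope.

Section Defs.
Variable F : fieldType.

(* A B-module structure on an F-vector space V is a Lie algebra morphism
   B -> gl(V); since B has basis {L_{i,j}, C}, it is given by the images of
   the basis vectors, which are linear operators satisfying the bracket
   relations of B. *)
Record Bmod (V : lmodType F) := {
  Lop : int -> int -> V -> V;
  Cop : V -> V;
  Lop_linear : forall i j (a : F) (x y : V), Lop i j (a *: x + y) = a *: Lop i j x + Lop i j y;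
  Cop_linear : forall (a : F) (x y : V), Cop (a *: x + y) = a *: Cop x + Cop y;
  LL_bracket : forall i j k l (x : V),
    Lop i j (Lop k l x) - Lop k l (Lop i j x) =
      ((j + 1) * k - i * (l + 1))%:~R *: Lop (i + k) (j + l) x
      + (if (i == - k) && (j + l == -2) then i%:~R *: Cop x else 0);
  CL_bracket : forall i j (x : V), Cop (Lop i j x) - Lop i j (Cop x) = 0
}.

Section Module.
Variables (V : lmodType F) (rho : Bmod V).

Definition subspace (S : V -> Prop) : Prop :=
  [/\ S 0, (forall x y, S x -> S y -> S (x + y)) & (forall (a : F) x, S x -> S (a *: x))].

Definition submodule (S : V -> Prop) : Prop :=
  [/\ subspace S, (forall i j x, S x -> S (Lop rho i j x)) & (forall x, S x -> S (Cop rho x))].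

Definition irreducible : Prop :=
  (exists v : V, v != 0) /\
  forall S, submodule S -> (forall x, S x -> x = 0) \/ (forall x, S x).

Definition fin_dim (S : V -> Prop) : Prop :=
  exists (n : nat) (b : 'I_n -> V), forall x, S x ->
    exists k : 'I_n -> F, x = \sum_(i < n) k i *: b i.

Definition quasifinite : Prop :=
  exists W : int -> V -> Prop,
  [/\ (forall a, subspace (W a)),
      (forall a b i x, W b x -> W (a + b) (Lop rho a i x)) /\
      (forall b x, W b x -> W b (Cop rho x)),
      (forall v : V, exists (s : seq int) (comp : int -> V),
          (forall a, a \in s -> W a (comp a)) /\ v = \sum_(a <- s) comp a),
      (forall (s : seq int) (comp : int -> V), uniq s ->
          (forall a, a \in s -> W a (comp a)) -> \sum_(a <- s) comp a = 0 ->
          forall a, a \in s -> comp a = 0)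
    & forall a, fin_dim (W a)].
End Module.

(* A weight Lambda in B_0^*, B_0 having basis {L_{0,i} | i in Z} u {C}. *)
Record weight := { wc : F;              (* central charge c = Lambda(C) *)
                   wL : int -> F }.     (* wL i = Lambda(L_{0,i}) *)

Definition label (Lam : weight) (i : int) : F := wL Lam (i - 1).

Definition hw_vector (V : lmodType F) (rho : Bmod V) (Lam : weight) (v : V) : Prop :=
  [/\ forall a i, 0 < a -> Lop rho a i v = 0,
      forall i, Lop rho 0 i v = wL Lam i *: v
    & Cop rho v = wc Lam *: v].

Definition generates (V : lmodType F) (rho : Bmod V) (v : V) : Prop :=
  forall S, submodule rho S -> S v -> forall x, S x.

Definition is_hw_module (V : lmodType F) (rho : Bmod V) (Lam : weight) : Prop :=
  exists v : V, hw_vector rho Lam v /\ generates rho v.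

Definition is_hom (V W : lmodType F) (rho : Bmod V) (sigma : Bmod W) (f : V -> W) : Prop :=
  [/\ forall (a : F) x y, f (a *: x + y) = a *: f x + f y,
      forall i j x, f (Lop rho i j x) = Lop sigma i j (f x)
    & forall x, f (Cop rho x) = Cop sigma (f x)].

(* Verma module M(Lambda) = U(B)/I(Lambda) with v_Lambda = image of 1,
   characterized by its defining universal property: it is a highest weight
   module of weight Lambda generated by v_Lambda, and for every module W and
   every w in W annihilated by B_+ on which B_0 acts by Lambda there is a
   unique module homomorphism M -> W sending v_Lambda to w. *)
Definition is_Verma (M : lmodType F) (rhoM : Bmod M) (Lam : weight) (m : M) : Prop :=
  [/\ hw_vector rhoM Lam m, generates rhoM m &
      forall (W : lmodType F) (sigma : Bmod W) (w : W), hw_vector sigma Lam w ->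
        (exists f : M -> W, is_hom rhoM sigma f /\ f m = w) /\
        (forall f g : M -> W, is_hom rhoM sigma f -> is_hom rhoM sigma g ->
            f m = w -> g m = w -> forall x, f x = g x)].

(* V is isomorphic to M(Lambda)/N with N a nonzero submodule: i.e. there is a
   surjective module homomorphism M(Lambda) -> V with nonzero kernel. *)
Definition proper_Verma_quotient (V : lmodType F) (rho : Bmod V) (Lam : weight) : Prop :=
  forall (M : lmodType F) (rhoM : Bmod M) (m : M), is_Verma rhoM Lam m ->
    exists f : M -> V, [/\ is_hom rhoM rho f,
                           (forall y : V, exists x, f x = y)
                         & exists x : M, x != 0 /\ f x = 0].

Definition series := nat -> F.   (* coefficient sequence of sum_n f n z^n *)

Definition sderiv (f : series) : series := fun n => f n.+1 *+ n.+1.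

Definition apply_diffop (P : {poly F}) (f : series) : series :=
  fun n => \sum_(k < size P) P`_k * iter k sderiv f n.

Definition satisfies_ode (P : {poly F}) (f : series) : Prop :=
  P != 0 /\ forall n, apply_diffop P f n = 0.

Definition quasipolynomial (f : series) : Prop := exists P, satisfies_ode P f.

Definition Delta (Lam : weight) (j : int) : series :=
  fun i => label Lam (i%:Z + j) / (i`!)%:R.

Definition Sigma (Lam : weight) (j : int) : series :=
  fun n => (if n is n'.+1 then Delta Lam (- j) n' else 0)
           - j%:~R * Delta Lam (- j - 1) n
           - (if (0 <= j) && (n == absz j) then wc Lam / ((absz j)`!)%:R else 0).

Definition cond3 (Lam : weight) : Prop :=
  (forall j, quasipolynomial (Sigma Lam j)) /\
  exists P : {poly F}, forall j, satisfies_ode P (Sigma Lam j).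

End Defs.

(* Main.v *)
(* Read [L_(i,j)] as [x^i t^(j+1)]: B is a central extension of the Poisson
   algebra of Laurent polynomials in [x], [t].  The weight enters through the
   functional [phi (t^n) = - n Lam_(n-1) + [n = 0] c], for which
   [x f . x^-1 g v = phi (f g) v], and all three conditions are equivalent to
   [phi] vanishing on a nonzero ideal [P F[t,t^-1]].  Up to a factor [-1/n!],
   the coefficient of [z^n] in [Sigma_j] is [phi (t^(n-j))], whence (3).

   In a quasifinite module the vectors [x^-1 t^m v] are linearly dependent,
   which gives [P].  Conversely such a [P] makes [x^-1 P g v] singular, hence
   zero in V; brackets then show that [x^-a P^(a+2n) g] kills the weight space
   of degree [-n], so that weight spaces are finite dimensional.

   Given [P], the vector [x^-1 P m] lies in the kernel of [M(Lam) -> V]; it is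
   nonzero in [M(Lam)] because it acts nontrivially on a highest weight vector
   of the B-module [Hom(U(B), V)].

   If there is no [P], let [u] in the tensor algebra of [B_-] kill [v] and let
   [s] be its symbol in the symmetric algebra.  Acting by [x t^k] on [u v] and
   letting [k] vary shows, by induction on the degree, that [s] involves only
   [B_(-1)] and that the contractions of [s] with [phi (t^k _)] vanish, so
   [s = 0].  Hence [u] kills every highest weight vector of weight [Lam]: V
   itself is a Verma module, and being irreducible it is not a proper quotient. *)
Require Import Defs.
From HB Require Import structures.
From mathcomp Require Import all_boot all_order all_algebra.
From mathcomp Require Import zify ring.
From mathcomp Require Import boolp functions.
Set Implicit Arguments. Unset Strict Implicit. Unset Printing Implicit Defensive.
Import Order.TTheory GRing.Theory Num.Theory.
Local Open Scope ring_scope.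

Lemma intr_eq0_char0 (F : fieldType) : [pchar F] =i pred0 ->
  forall z : int, (z%:~R == 0 :> F) = (z == 0).
Proof.
move=> /pcharf0P ch [] n; first by rewrite -pmulrn ch.
by rewrite NegzE mulrNz oppr_eq0 -pmulrn ch.
Qed.

(** * The action of the Lie algebra in Laurent coordinates *)

Section Operators.
Variables (F : fieldType) (V : lmodType F) (rho : Bmod V).

HB.instance Definition _ i j :=
  GRing.isLinear.Build F V V *:%R (Lop rho i j) (Lop_linear rho i j).
HB.instance Definition _ :=
  GRing.isLinear.Build F V V *:%R (Cop rho) (Cop_linear rho).

(* [X i m] is the action of [x^i t^m] when [L_(i,j)] is read as [x^i t^(j+1)];
   the bracket is then a central extension of the Poisson bracket
   [f_t * x g_x - x f_x * g_t] of Laurent polynomials. *)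
Definition X (i m : int) (v : V) : V := Lop rho i (m - 1) v.

HB.instance Definition _ i m :=
  GRing.isLinear.Build F V V *:%R (X i m) (Lop_linear rho i (m - 1)).

Lemma X_bracket i k m n v :
  X i m (X k n v) = X k n (X i m v) + (m * k - i * n)%:~R *: X (i + k) (m + n - 1) v
    + (if (i == - k) && (m + n == 0) then i%:~R *: Cop rho v else 0).
Proof.
move: (LL_bracket rho i (m - 1) k (n - 1) v) => /eqP; rewrite subr_eq => /eqP.
rewrite /X => ->; rewrite !subrK.
have -> : m - 1 + (n - 1) = m + n - 1 - 1 :> int by lia.
have -> : (m + n - 1 - 1 == -2 :> int) = (m + n == 0) by lia.
by rewrite addrC addrA.
Qed.

Lemma X_commutator i k m n v :
  X i m (X k n v) - X k n (X i m v) = (m * k - i * n)%:~R *: X (i + k) (m + n - 1) v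
    + (if (i == - k) && (m + n == 0) then i%:~R *: Cop rho v else 0).
Proof. by apply/eqP; rewrite subr_eq [X in _ == X]addrC [X in _ == X]addrA -X_bracket. Qed.

Lemma XC i m v : Cop rho (X i m v) = X i m (Cop rho v).
Proof. by apply/eqP; rewrite -subr_eq0 /X CL_bracket. Qed.

Lemma submoduleP (S : V -> Prop) : subspace S -> (forall i m v, S v -> S (X i m v)) ->
  (forall v, S v -> S (Cop rho v)) -> submodule rho S.
Proof.
move=> hS hX hC; split=> // i j v /(hX i (j + 1)); by rewrite /X addrK.
Qed.

Lemma subspace_sum (S : V -> Prop) (I : Type) (r : seq I) (P : pred I) (f : I -> V) :
  subspace S -> (forall i, P i -> S (f i)) -> S (\sum_(i <- r | P i) f i).
Proof. by move=> [h0 hD _] hf; elim/big_ind: _. Qed.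

(** The adjoint action of [L_(0,0)] is [x d/dx], so [X 0 1] reads off degrees. *)
Lemma grading_op i m v : X 0 1 (X i m v) = X i m (X 0 1 v) + i%:~R *: X i m v.
Proof.
rewrite X_bracket mul1r mul0r subr0 add0r (_ : 1 + m - 1 = m); last by lia.
by case: ifP => [_|]; rewrite ?scale0r addr0.
Qed.

End Operators.

Section Eigenvectors.
Variables (F : fieldType) (charF0 : [pchar F] =i pred0) (V : lmodType F).

(** Applying [T - (la + a)] removes the term at [a] and rescales the others by nonzero integers,
    which stay nonzero in characteristic 0. *)
Lemma eigen_indep (T : {linear V -> V}) (la : F) (s : seq int) (x : int -> V) :
  uniq s -> (forall n, n \in s -> T (x n) = (la + n%:~R) *: x n) ->
  \sum_(n <- s) x n = 0 -> forall n, n \in s -> x n = 0.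
Proof.
elim: s x => [|a s IH] x //= /andP[as_ us] hT; rewrite big_cons => h0.
have xs0 n : n \in s -> x n = 0.
  move=> ns; have na : n != a by apply: contraNneq as_ => <-.
  suff /eqP : (n - a)%:~R *: x n = 0.
    rewrite scaler_eq0 (intr_eq0_char0 charF0) subr_eq0 (negPf na). by move/eqP.
  apply: (IH (fun n => (n - a)%:~R *: x n)) => // [k ks|].
    by rewrite linearZZ hT ?inE ?ks ?orbT // !scalerA mulrC.
  move/(congr1 (fun v => T v - (la + a%:~R) *: v)): h0.
  rewrite linearD hT ?mem_head // linear0 scaler0 subr0 scalerDr opprD addrACA subrr add0r.
  rewrite linear_sum scaler_sumr -sumrB => h; rewrite -[RHS]h.
  rewrite [LHS]big_seq [RHS]big_seq; apply: eq_bigr => k ks.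
  by rewrite hT ?inE ?ks ?orbT // -scalerBl opprD addrACA subrr add0r rmorphB.
move: h0; rewrite big_seq big1 ?addr0 => [xa n|n /xs0//].
by rewrite inE => /orP[/eqP->|/xs0].
Qed.

End Eigenvectors.

(** * The functional [phi] and the generating series *)

Section Recurrence.
Variables (F : fieldType) (charF0 : [pchar F] =i pred0) (Lam : weight F).

(* The functional [h |-> Lam(- h' + [t^0]h C)] on Laurent polynomials; it pairs
   [B_1] and [B_(-1)]: [x f . x^-1 g] acts on a highest weight vector by
   [phi (f g)]. *)
Definition phi (n : int) : F :=
  - (n%:~R * wL Lam (n - 2)) + (if n == 0 then wc Lam else 0).

Definition recurrent : Prop := exists P : {poly F}, P != 0 /\
  forall m : int, \sum_(k < size P) P`_k * phi (m + k%:Z) = 0.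

Lemma fact_neq0 n : n`!%:R != 0 :> F.
Proof. by rewrite (pcharf0P F).1 // -lt0n fact_gt0. Qed.

(** The first two series contribute the same value [wL Lam (n - j - 2)], with factors [n / n!] and
    [- j / n!]; the last one contributes only at [n = j], where it is the central part of [phi]. *)
Lemma Sigma_coef j n : Sigma Lam j n = - phi (n%:Z - j) / n`!%:R.
Proof.
rewrite /Sigma /phi /Delta /label opprD opprK mulrDl mulNr.
have -> : (0 <= j) && (n == absz j) = (n%:Z - j == 0) by lia.
congr (_ + _); last first.
  case: eqP => h; last by rewrite mul0r oppr0.
  by have -> : absz j = n by lia.
case: n => [|n].
  rewrite fact0 !divr1 !sub0r rmorphN /= mulNr; congr (- (_ * wL _ _)); lia.
rewrite factS natrM invfM mulrA.
have -> : n.+1%:Z + (- j - 1) - 1 = n.+1%:Z - j - 2 by lia.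
have -> : n%:Z - j - 1 = n.+1%:Z - j - 2 by lia.
have n0 : n.+1%:R != 0 :> F by rewrite (pcharf0P F).1.
rewrite rmorphB /= -pmulrn; move: (n.+1%:R : F) n0 => N n0.
by field; rewrite fact_neq0 n0.
Qed.

Lemma iter_sderiv (f : series F) k n :
  iter k (@sderiv F) f n = f (n + k)%N * ((n + k)`!%:R / n`!%:R).
Proof.
elim: k n => [|k IH] n /=; first by rewrite addn0 divff ?mulr1 ?fact_neq0.
rewrite /sderiv IH addSnnS -[LHS]mulr_natr -mulrA; congr (_ * _).
rewrite [n.+1`!]factS natrM; have n0 : n.+1%:R != 0 :> F by rewrite (pcharf0P F).1.
by move: (n.+1%:R : F) n0 => N n0; field; rewrite fact_neq0 n0.
Qed.

Lemma apply_diffop_Sigma (P : {poly F}) j n :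
  apply_diffop P (Sigma Lam j) n =
    - (\sum_(k < size P) P`_k * phi (n%:Z - j + k%:Z)) / n`!%:R.
Proof.
rewrite /apply_diffop mulNr mulr_suml -sumrN; apply: eq_bigr => k _.
rewrite iter_sderiv Sigma_coef PoszD addrAC.
by field; rewrite !fact_neq0.
Qed.

(** On exponential generating series differentiation shifts coefficients, and [n - j] runs through
    all integers, so one equation valid for every [j] is a two-sided recurrence for [phi]. *)
Lemma cond3_recurrent : cond3 Lam <-> recurrent.
Proof.
split=> [[_ [P hP]]|[P [P0 hP]]].
  exists P; split=> [|m]; first by case: (hP 0).
  have [_ /(_ 0)] := hP (- m); rewrite apply_diffop_Sigma add0r opprK fact0 divr1.
  by move/eqP; rewrite oppr_eq0 => /eqP.
have h j : satisfies_ode P (Sigma Lam j).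
  by split=> // n; rewrite apply_diffop_Sigma hP oppr0 mul0r.
by split=> [j|]; exists P.
Qed.

End Recurrence.

Lemma sum_by_key (V : nmodType) (T K : eqType) (key : T -> K) (s : seq T) (f : T -> V) :
  \sum_(t <- s) f t = \sum_(k <- undup (map key s)) \sum_(t <- s | key t == k) f t.
Proof.
rewrite (exchange_big_dep predT) //= big_seq [RHS]big_seq; apply: eq_bigr => t ts.
rewrite (eq_bigl (pred1 (key t))) => [|k]; last by rewrite eq_sym.
rewrite -big_filter filter_pred1_uniq ?big_seq1 ?undup_uniq //.
by rewrite mem_undup map_f.
Qed.

(** * From quasifiniteness to a recurrence *)

Section HighestWeightVector.
Variables (F : fieldType) (V : lmodType F) (rho : Bmod V) (Lam : weight F) (v : V).
Hypothesis hv : hw_vector rho Lam v.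

Lemma hwX_gt0 i m : 0 < i -> X rho i m v = 0.
Proof. by case: hv => h _ _ hi; rewrite /X h. Qed.

Lemma hwX0 m : X rho 0 m v = wL Lam (m - 1) *: v.
Proof. by case: hv => _ h _; rewrite /X h. Qed.

Lemma hwC : Cop rho v = wc Lam *: v.
Proof. by case: hv. Qed.

Lemma hw_phi k m : X rho 1 k (X rho (-1) m v) = phi Lam (k + m) *: v.
Proof.
rewrite X_bracket hwX_gt0 // linear0 add0r subrr hwX0 scalerA opprK eqxx /= /phi scalerDl.
congr (_ *: _ + _).
  rewrite mul1r -mulNr -rmorphN /=; congr (_%:~R * wL _ _); lia.
by case: eqP => _; rewrite ?scale0r // hwC mulr1z scale1r.
Qed.

End HighestWeightVector.

Lemma widen_poly_sum (F : fieldType) (P : {poly F}) (N : nat) (g : nat -> F) :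
  (size P <= N)%N -> \sum_(k < size P) P`_k * g k = \sum_(k < N) P`_k * g k.
Proof.
move=> h; rewrite (big_ord_widen N (fun k => P`_k * g k) h) big_mkcond.
by apply: eq_bigr => k _; case: ltnP => // hk; rewrite nth_default ?mul0r.
Qed.

(** Any [n + 1] vectors in a span of [n] are dependent; the relation is stored as a polynomial so
    that index [k] stands for [t^k]. *)
Lemma span_dependent (F : fieldType) (V : lmodType F) (S : V -> Prop) (g : nat -> V) :
  fin_dim S -> (forall k, S (g k)) ->
  exists N (P : {poly F}), [/\ P != 0, (size P <= N)%N & \sum_(k < N) P`_k *: g k = 0].
Proof.
move=> [n [b hb]] hg.
have [K hK] : exists K : nat -> 'I_n -> F, forall k, g k = \sum_(i < n) K k i *: b i.
  by exists (fun k => projT1 (cid (hb _ (hg k)))) => k; case: cid.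
pose A := \matrix_(k < n.+1, i < n) K k i.
have : kermx A != 0.
  by rewrite kermx_eq0 -row_leq_rank -ltnNge (leq_ltn_trans (rank_leq_col A)).
case/rowV0Pn => u /sub_kermxP uA u0.
exists n.+1, (rVpoly u); split; last 1 first.
- under eq_bigr => k _ do rewrite coef_rVpoly_ord hK scaler_sumr.
  rewrite exchange_big big1 //= => i _.
  under eq_bigr => k _ do rewrite scalerA.
  rewrite -scaler_suml; move/matrixP/(_ 0 i): uA; rewrite !mxE => uAi.
  rewrite (_ : \sum_k _ = 0) ?scale0r // -[RHS]uAi.
  by apply: eq_bigr => k _; rewrite mxE.
- by apply: contraNneq u0 => h; rewrite -[u]rVpolyK h linear0.
exact: size_poly.
Qed.

Section Quasifinite.
Variables (F : fieldType) (V : lmodType F) (rho : Bmod V) (Lam : weight F) (v : V).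

(** The given grading need not be adapted to [v], but the components of [v] are again highest weight
    vectors of weight [Lam]. For a nonzero one, its images under the [x^-1 t^k] share a
    finite-dimensional space, and [x t^m] turns a relation among them into a recurrence. *)
Lemma quasifinite_recurrent :
  hw_vector rho Lam v -> v != 0 -> quasifinite rho -> recurrent Lam.
Proof.
move=> hv v0 [W [hsub [hX hC] hsum hdir hfin]].
have [s [comp [us hcomp vE]]] : exists s comp,
    [/\ uniq s, forall a, W a (comp a) & v = \sum_(a <- s) comp a].
  have [s [comp [hcomp ->]]] := hsum v.
  exists (undup s), (fun a => \sum_(b <- s | b == a) comp b); split.
  - exact: undup_uniq.
  - move=> a; rewrite big_seq_cond; apply: subspace_sum => // b /andP[bs /eqP <-].
    exact: hcomp.
  by rewrite (sum_by_key id) map_id.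
(* Directness of the grading, for families translated by a degree [d]. *)
have hshift d (g : int -> V) : (forall a, W (d + a) (g a)) ->
    \sum_(a <- s) g a = 0 -> forall a, a \in s -> g a = 0.
  move=> hg g0 a sa.
  have := hdir (map (+%R d) s) (fun b => g (b - d)) _ _ _ (d + a).
  rewrite addrAC subrr add0r; apply.
  - by rewrite map_inj_uniq //; apply: addrI.
  - by move=> b _; have := hg (b - d); rewrite addrC subrK.
  - by rewrite big_map -[RHS]g0; apply: eq_bigr => b _; rewrite addrAC subrr add0r.
  - exact: map_f.
have scaleW a x c : W a x -> W a (c *: x) by case: (hsub a) => _ _; apply.
have subW a x y : W a x -> W a y -> W a (x - y).
  by move=> hx hy; case: (hsub a) => _ hD _; rewrite -scaleN1r; apply/hD/scaleW.
have hwa a : a \in s -> hw_vector rho Lam (comp a).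
  move=> sa; split.
  - move=> i m i0; apply: (hshift i (fun a => Lop rho i m (comp a))) => // [b|]; first exact: hX.
    by rewrite -linear_sum -vE /=; case: hv => ->.
  - move=> m; apply/eqP; rewrite -subr_eq0; apply/eqP.
    apply: (hshift 0 (fun a => Lop rho 0 m (comp a) - wL Lam m *: comp a)) => // [b|].
      apply: subW; first exact: hX.
      by rewrite add0r; apply: scaleW.
    by rewrite sumrB -linear_sum -scaler_sumr -vE /=; case: hv => _ -> _; rewrite subrr.
  - apply/eqP; rewrite -subr_eq0; apply/eqP.
    apply: (hshift 0 (fun a => Cop rho (comp a) - wc Lam *: comp a)) => // [b|].
      by rewrite add0r; apply: subW; [apply: hC|apply: scaleW].
    by rewrite sumrB -linear_sum -scaler_sumr -vE /=; case: hv => _ _ ->; rewrite subrr.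
have [a sa ca0] : exists2 a, a \in s & comp a != 0.
  apply: contrapT => h; case/eqP: v0; rewrite vE big_seq big1 // => a sa.
  by apply: contrapT => /eqP ca; apply: h; exists a.
have [N [P [P0 sP hP]]] := @span_dependent _ _ _ (fun k => X rho (-1) k (comp a))
  (hfin (-1 + a)) (fun k => hX _ _ _ _ (hcomp a)).
exists P; split=> // m; rewrite (widen_poly_sum (fun k => phi Lam (m + k%:Z)) sP).
move/(congr1 (X rho 1 m)): hP; rewrite linear_sum linear0 => /eqP.
under eq_bigr => k _ do rewrite linearZZ /= (hw_phi (hwa _ sa)) scalerA.
by rewrite -scaler_suml scaler_eq0 (negPf ca0) orbF => /eqP.
Qed.

End Quasifinite.

(** * Words in the negative part *)

Fixpoint splits (T : Type) (w : seq T) : seq (seq T * T * seq T) :=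
  if w is x :: w' then ([::], x, w') :: [seq (x :: t.1.1, t.1.2, t.2) | t <- splits w']
  else [::].

Lemma splits_cat_cons (T : eqType) (w : seq T) t :
  t \in splits w -> w = t.1.1 ++ t.1.2 :: t.2.
Proof.
elim: w t => [|x w IH] t //=; rewrite inE => /orP[/eqP->//|].
by case/mapP => t' /IH -> ->.
Qed.

Lemma letters_splits (T : Type) (w : seq T) : [seq t.1.2 | t <- splits w] = w.
Proof. by elim: w => [|x w IH] //=; rewrite -map_comp IH. Qed.

(* The letter [(a, m)] stands for [x^-(a+1) t^m], so that every letter has
   negative degree. *)
Notation word := (seq (nat * int)).

Definition wt (w : word) : nat := sumn [seq x.1.+1 | x <- w].

Lemma wt_cat w1 w2 : wt (w1 ++ w2) = (wt w1 + wt w2)%N.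
Proof. by rewrite /wt map_cat sumn_cat. Qed.

Lemma wt_cons x w : wt (x :: w) = (x.1.+1 + wt w)%N.
Proof. by []. Qed.

Lemma size_wt w : (size w <= wt w)%N.
Proof. by elim: w => //= x w IH; rewrite wt_cons; lia. Qed.

Section Action.
Variables (F : fieldType) (V : lmodType F) (rho : Bmod V).

Definition Y (x : nat * int) : V -> V := X rho (- (x.1.+1)%:Z) x.2.

HB.instance Definition _ x := GRing.Linear.copy (Y x) (X rho (- (x.1.+1)%:Z) x.2).

Definition act (w : word) (z : V) : V := foldr Y z w.

Lemma act_cons x w z : act (x :: w) z = Y x (act w z).
Proof. by []. Qed.

Lemma act_nil z : act [::] z = z.
Proof. by []. Qed.

#[local] Arguments act : simpl never.

Lemma act_is_linear w : linear (act w).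
Proof. by elim: w => // x w IH a y z; rewrite !act_cons IH linearP. Qed.

HB.instance Definition _ w := GRing.isLinear.Build F V V *:%R (act w) (act_is_linear w).

Lemma act_cat w1 w2 z : act (w1 ++ w2) z = act w1 (act w2 z).
Proof. by rewrite /act foldr_cat. Qed.

Lemma act_commutator (D : {linear V -> V}) w z :
  D (act w z) = act w (D z) +
    \sum_(t <- splits w) act t.1.1 (D (Y t.1.2 (act t.2 z)) - Y t.1.2 (D (act t.2 z))).
Proof.
elim: w => [|x w IH] /=; first by rewrite big_nil addr0.
rewrite big_cons /= big_map /= !act_cons act_nil.
under eq_bigr => t _ do rewrite act_cons.
by rewrite -linear_sum addrCA -linearD -IH subrK.
Qed.

Lemma Cop_act w z : Cop rho (act w z) = act w (Cop rho z).
Proof. by elim: w => // x w IH; rewrite !act_cons XC IH. Qed.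

(** Lists of weighted words represent elements of the tensor algebra of [B_-], with no ordering
    imposed on the letters. *)
Definition ev (u : seq (F * word)) (z : V) : V := \sum_(t <- u) t.1 *: act t.2 z.

Lemma ev_cat u1 u2 z : ev (u1 ++ u2) z = ev u1 z + ev u2 z.
Proof. by rewrite /ev big_cat. Qed.

Lemma ev_scale c u z : ev [seq (c * t.1, t.2) | t <- u] z = c *: ev u z.
Proof. by rewrite /ev big_map scaler_sumr; apply: eq_bigr => t _; rewrite scalerA. Qed.

Lemma ev_flatten (T : Type) (s : seq T) (f : T -> seq (F * word)) z :
  ev (flatten [seq f t | t <- s]) z = \sum_(t <- s) ev (f t) z.
Proof. by elim: s => [|t s IH] /=; rewrite ?big_cons ?ev_cat ?IH // /ev !big_nil. Qed.

Lemma ev_prefix p u z : ev [seq (t.1, p ++ t.2) | t <- u] z = act p (ev u z).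
Proof.
rewrite /ev big_map linear_sum; apply: eq_bigr => t _.
by rewrite linearZZ act_cat.
Qed.

Lemma act_grading Lam v w : hw_vector rho Lam v ->
  X rho 0 1 (act w v) = (wL Lam 0 + (- (wt w)%:Z)%:~R) *: act w v.
Proof.
move=> hv; elim: w => [|x w IH]; first by rewrite act_nil (hwX0 hv) addr0.
rewrite act_cons grading_op IH linearZZ -scalerDl wt_cons; congr (_ *: _).
by rewrite -addrA -rmorphD; congr (_ + _%:~R); lia.
Qed.

End Action.

Section Spanning.
Variables (F : fieldType) (Lam : weight F).

(* The expansion [u] does not depend on the module: this is what makes the
   assignment [ev u v |-> ev u w] below a module homomorphism. *)
Lemma X_act_expansion i m w : exists u : seq (F * word),
  forall (W : lmodType F) (sigma : Bmod W) (z : W), hw_vector sigma Lam z ->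
    X sigma i m (act sigma w z) = ev sigma u z.
Proof.
elim: w i m => [|x w IH] i m; last have [i0|i0] := ltP i 0.
- have [i0|i0|->] := ltgtP i 0.
  + exists [:: (1, [:: (absz (i + 1), m)])] => W sigma z _.
    by rewrite /ev big_seq1 scale1r /= /Y /=; congr (X _ _ _ _); lia.
  + by exists [::] => W sigma z hz; rewrite /ev big_nil act_nil (hwX_gt0 hz).
  + by exists [:: (wL Lam (m - 1), [::])] => W sigma z hz; rewrite /ev big_seq1 !act_nil (hwX0 hz).
- exists [:: (1, (absz (i + 1), m) :: x :: w)] => W sigma z _.
  by rewrite /ev big_seq1 scale1r [RHS]act_cons /Y /=; congr (X _ _ _ _); lia.
(* For [i >= 0], move [x^i t^m] past the first letter; the operator and the bracket then act on a
   shorter word. *)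
have [u1 h1] := IH i m.
have [u2 h2] := IH (i - x.1.+1%:Z) (m + x.2 - 1).
exists ([seq (t.1, x :: t.2) | t <- u1] ++
  [seq ((m * - (x.1.+1)%:Z - i * x.2)%:~R * t.1, t.2) | t <- u2] ++
  (if (i == - - (x.1.+1)%:Z) && (m + x.2 == 0) then [:: (i%:~R * wc Lam, w)] else [::])).
move=> W sigma z hz; rewrite act_cons {1}/Y X_bracket h1 // h2 // !ev_cat ev_scale addrA.
rewrite (ev_prefix sigma [:: x]) act_cons act_nil; congr (_ + _).
case: ifP => _; rewrite /ev ?big_nil ?big_seq1 //.
by rewrite Cop_act (hwC hz) linearZZ scalerA.
Qed.

Lemma X_ev_expansion i m u : exists u' : seq (F * word),
  forall (W : lmodType F) (sigma : Bmod W) (z : W), hw_vector sigma Lam z ->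
    X sigma i m (ev sigma u z) = ev sigma u' z.
Proof.
elim: u => [|t u [u' IH]].
  by exists [::] => W sigma z _; rewrite /ev !big_nil linear0.
have [u1 h1] := X_act_expansion i m t.2.
exists ([seq (t.1 * r.1, r.2) | r <- u1] ++ u') => W sigma z hz.
by rewrite ev_cat ev_scale -h1 // -IH // -linearZZ -linearD /ev big_cons.
Qed.

Lemma Cop_ev (W : lmodType F) (sigma : Bmod W) (z : W) u : hw_vector sigma Lam z ->
  Cop sigma (ev sigma u z) = wc Lam *: ev sigma u z.
Proof.
move=> hz; rewrite /ev linear_sum scaler_sumr; apply: eq_bigr => t _ /=.
by rewrite linearZZ /= Cop_act (hwC hz) linearZZ !scalerA mulrC.
Qed.

Lemma ev_onto (V : lmodType F) (rho : Bmod V) v : hw_vector rho Lam v ->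
  generates rho v -> forall x, exists u, x = ev rho u v.
Proof.
move=> hv gen; apply: gen; last by exists [:: (1, [::])]; rewrite /ev big_seq1 scale1r.
apply: submoduleP.
- split; first by exists [::]; rewrite /ev big_nil.
    by move=> _ _ [u1 ->] [u2 ->]; exists (u1 ++ u2); rewrite ev_cat.
  by move=> a _ [u ->]; exists [seq (a * t.1, t.2) | t <- u]; rewrite ev_scale.
- by move=> i m _ [u ->]; have [u' h] := X_ev_expansion i m u; exists u'; rewrite h.
- by move=> _ [u ->]; exists [seq (wc Lam * t.1, t.2) | t <- u]; rewrite ev_scale Cop_ev.
Qed.

End Spanning.

Section WeightDecomposition.
Variables (F : fieldType) (charF0 : [pchar F] =i pred0) (V : lmodType F) (rho : Bmod V).
Variables (Lam : weight F) (v : V).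
Hypothesis hv : hw_vector rho Lam v.

Definition homog (n : nat) (u : seq (F * word)) := [seq t <- u | wt t.2 == n].

Lemma ev_homog u (W : lmodType F) (sigma : Bmod W) (z : W) :
  ev sigma u z = \sum_(n <- undup [seq wt t.2 | t <- u]) ev sigma (homog n u) z.
Proof.
rewrite {1}/ev (sum_by_key (fun t => wt t.2)); apply: eq_bigr => n _.
by rewrite /ev big_filter.
Qed.

Lemma ev_homog_grading n u :
  X rho 0 1 (ev rho (homog n u) v) = (wL Lam 0 + (- n%:Z)%:~R) *: ev rho (homog n u) v.
Proof.
rewrite /ev linear_sum scaler_sumr big_filter [RHS]big_filter.
apply: eq_bigr => t /eqP wtt /=.
by rewrite linearZZ /= (act_grading _ hv) wtt !scalerA mulrC.
Qed.

(** Components of different degree lie in different eigenspaces of [X 0 1]; this reduces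
    annihilators of [v] to homogeneous ones. *)
Lemma ev_homog_eq0 u : ev rho u v = 0 -> forall n, ev rho (homog n u) v = 0.
Proof.
rewrite ev_homog; set s := undup _ => h n.
have [ns|/negP ns] := boolP (n \in s); last first.
  rewrite /ev big_filter big_seq_cond big1 // => t /andP[tu /eqP wtt].
  by case: ns; rewrite mem_undup -wtt; apply/mapP; exists t.
have := @eigen_indep _ charF0 _ (X rho 0 1) (wL Lam 0) [seq - k%:Z | k <- s]
  (fun a => ev rho (homog (absz a) u) v) _ _ _ (- n%:Z).
rewrite abszN absz_nat; apply.
- by rewrite map_inj_uniq ?undup_uniq // => a b /eqP; rewrite eqr_opp => /eqP [].
- by move=> _ /mapP[k _ ->]; rewrite abszN absz_nat; apply: ev_homog_grading.
- by rewrite big_map -[RHS]h; apply: eq_bigr => k _; rewrite abszN absz_nat.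
- by apply/mapP; exists n.
Qed.

End WeightDecomposition.

(** * Sequences annihilated by a polynomial *)

Section Dot.
Variables (F : fieldType) (V : lmodType F).
Implicit Types (s : int -> V) (P Q : {poly F}).

(* When [s n] is linear in the monomial [t^n], [dot s m P] is the value of the
   same linear map at [t^m P(t)]. *)
Definition dot s (m : int) P : V := \sum_(k < size P) P`_k *: s (m + k%:Z).

Lemma dot_widen N s m P : (size P <= N)%N -> dot s m P = \sum_(k < N) P`_k *: s (m + k%:Z).
Proof.
move=> h; rewrite /dot (big_ord_widen N (fun k => P`_k *: s (m + k%:Z)) h) big_mkcond.
by apply: eq_bigr => k _; case: ltnP => // hk; rewrite nth_default ?scale0r.
Qed.

Lemma dot_is_linear s m : linear (dot s m).
Proof.
move=> a P Q; set N := maxn (size P) (size Q).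
have hP : (size P <= N)%N by rewrite leq_maxl.
have hQ : (size Q <= N)%N by rewrite leq_maxr.
rewrite (dot_widen s m hP) (dot_widen s m hQ) (@dot_widen N); last first.
  rewrite (leq_trans (size_polyD _ _)) // geq_max hQ andbT.
  exact: leq_trans (size_scale_leq _ _) hP.
rewrite scaler_sumr -big_split; apply: eq_bigr => k _ /=.
by rewrite coefD coefZ scalerDl scalerA.
Qed.

HB.instance Definition _ s m :=
  GRing.isLinear.Build F {poly F} V *:%R (dot s m) (dot_is_linear s m).

Lemma dotXn s m n : dot s m 'X^n = s (m + n%:Z).
Proof.
rewrite (@dot_widen n.+1) ?size_polyXn // big_ord_recr /= coefXn eqxx scale1r.
by rewrite big1 ?add0r // => k _; rewrite coefXn ltn_eqF // scale0r.
Qed.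

Lemma dotMXn s m P n : dot s m (P * 'X^n) = dot s (m + n%:Z) P.
Proof.
rewrite -[P in LHS]coefK poly_def mulr_suml linear_sum; apply: eq_bigr => k _.
by rewrite -scalerAl linearZZ -exprD /= dotXn PoszD -addrA [k%:Z + _]addrC.
Qed.

Lemma dotM s m P Q : dot s m (P * Q) = \sum_(l < size Q) Q`_l *: dot s (m + l%:Z) P.
Proof.
rewrite -[Q in LHS]coefK poly_def mulr_sumr linear_sum; apply: eq_bigr => k _.
by rewrite -scalerAr linearZZ /= dotMXn.
Qed.

Lemma dot_eq0 s P Q : (forall m, dot s m P = 0) -> P %| Q -> forall m, dot s m Q = 0.
Proof.
move=> h /dvdpP [R ->] m; rewrite mulrC dotM big1 // => l _.
by rewrite h scaler0.
Qed.

Lemma dot_deriv s m P : dot s m P^`() = \sum_(k < size P) (P`_k *+ k) *: s (m + k%:Z - 1).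
Proof.
have hsz : (size P^`() <= (size P).-1)%N.
  have [->|P0] := eqVneq P 0; first by rewrite deriv0 size_poly0.
  by rewrite -ltnS prednK ?lt_size_deriv // size_poly_gt0.
rewrite (dot_widen s m hsz).
case: (size P) => [|n]; first by rewrite !big_ord0.
rewrite big_ord_recl /= mulr0n scale0r add0r; apply: eq_bigr => k _.
by rewrite coef_deriv; congr (_ *: s _); rewrite /bump /=; lia.
Qed.

(* A sequence satisfying a two-sided recurrence with invertible extreme
   coefficients is determined linearly by a window of values. *)
Lemma recurrence_window s P (S : V -> Prop) : subspace S -> P`_0 != 0 ->
  (forall m, dot s m P = 0) -> (forall k, (k < size P)%N -> S (s k%:Z)) ->
  forall m, S (s m).
Proof.
move=> hS P0 hP hwin.
have P_neq0 : P != 0 by apply: contraNneq P0 => ->; rewrite coef0.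
have lP0 : lead_coef P != 0 by rewrite lead_coef_eq0.
have [d sP] : exists d, size P = d.+1 by exists (size P).-1; rewrite prednK // lt0n size_poly_eq0.
have [S0 SD SZ] := hS.
have solve (c : F) x y : c != 0 -> c *: x + y = 0 -> S y -> S x.
  move=> c0 h Sy; rewrite -(scalerK c0 x) (_ : c *: x = - y); last first.
    by apply/eqP; rewrite -addr_eq0 h.
  by apply: (SZ); rewrite -scaleN1r; apply: SZ.
(* The window grows by one index on each side: the constant coefficient solves for the lowest value,
   the leading one for the highest. *)
have main N : forall m : int, - N%:Z <= m < (d.+1 + N)%:Z -> S (s m).
  elim: N => [|N IH] m hm.
    have -> : m = (absz m)%:Z by lia.
    by apply: hwin; rewrite sP; lia.
  have [hm1|hm1] := boolP (- N%:Z <= m < (d.+1 + N)%:Z); first exact: IH.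
  have [m0|m0] := ltP m 0.
    have := hP m; rewrite /dot sP big_ord_recl /= addr0 => h; apply: (solve _ _ _ P0 h).
    apply: subspace_sum => // k _; apply: SZ; apply: IH.
    by have := ltn_ord k; rewrite /= /bump /=; lia.
  have := hP (m - d%:Z); rewrite /dot sP big_ord_recr /= subrK addrC => h; apply: (solve _ _ _ _ h).
    by move: lP0; rewrite /lead_coef sP.
  apply: subspace_sum => // k _; apply: SZ; apply: IH.
  by have := ltn_ord k; lia.
by move=> m; apply: (main (absz m)); lia.
Qed.

End Dot.

Lemma dot_linear (F : fieldType) (V W : lmodType F) (f : {linear V -> W}) s m P :
  dot (fun n => f (s n)) m P = f (dot s m P).
Proof. by rewrite /dot linear_sum; apply: eq_bigr => k _; rewrite linearZZ. Qed.

(** Multiplication by [t] only shifts a two-sided sequence, so the largest power of [t] dividing [P]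
    can be removed. *)
Lemma recurrent_dot (F : fieldType) (Lam : weight F) : recurrent Lam ->
  exists2 P : {poly F}, P`_0 != 0 & forall m, dot (phi Lam : int -> F^o) m P = 0.
Proof.
move=> [P [P0 hP]].
have ex : exists k, P`_k != 0 by exists (size P).-1; rewrite -lead_coefE lead_coef_eq0.
case: (ex_minnP ex) => k Pk kmin.
have PE : P = drop_poly k P * 'X^k.
  rewrite -[LHS](poly_take_drop k) (_ : take_poly k P = 0) ?add0r //.
  apply/polyP => i; rewrite coef_take_poly coef0; case: ltnP => // ik.
  by apply/eqP; apply: contraTT ik => /kmin; rewrite -leqNgt.
exists (drop_poly k P) => [|m]; first by rewrite coef_drop_poly add0n.
have <- : dot (phi Lam : int -> F^o) (m - k%:Z) P = 0 by apply: hP.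
by rewrite [in RHS]PE dotMXn subrK.
Qed.

(** * Singular vectors in the irreducible module *)

Section IrreducibleSingular.
Variables (F : fieldType) (charF0 : [pchar F] =i pred0) (V : lmodType F) (rho : Bmod V).
Variables (Lam : weight F) (v : V).
Hypotheses (Hirr : irreducible rho) (hv : hw_vector rho Lam v) (gen : generates rho v).

Lemma hw_neq0 : v != 0.
Proof.
case: Hirr => [[x x0] _]; apply: contraNneq x0 => v0.
have [u ->] := ev_onto hv gen x.
by rewrite v0 /ev big1 // => t _; rewrite linear0 scaler0.
Qed.

Lemma Cop_scalar x : Cop rho x = wc Lam *: x.
Proof. by have [u ->] := ev_onto hv gen x; apply: Cop_ev. Qed.

(* For [P] annihilated by [phi], this closure under [B_-] of the vectors
   [x^-1 t^m P . v] is a submodule. *)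
Inductive lowered (P : {poly F}) : V -> Prop :=
| lowered_base m : lowered P (dot (fun n => X rho (-1) n v) m P)
| lowered0 : lowered P 0
| loweredD x y : lowered P x -> lowered P y -> lowered P (x + y)
| loweredZ a x : lowered P x -> lowered P (a *: x)
| loweredY l x : lowered P x -> lowered P (Y rho l x).

(** On a base vector, [i >= 2] gives 0, [i = 1] gives a value of [phi] on a multiple of [P], and
    [i = 0] gives a combination of base vectors. Past a letter, the bracket has nonnegative degree
    or is a multiple of another letter. *)
Lemma lowered_X P i m x : (forall n, dot (phi Lam : int -> F^o) n P = 0) ->
  0 <= i -> lowered P x -> lowered P (X rho i m x).
Proof.
move=> hP i0 hx; elim: hx i m i0 => [n||y z _ IHy _ IHz|a y _ IHy|l y hy IHy] i m i0.
- rewrite -dot_linear; have [i2|] := ltP 1 i.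
    rewrite /dot big1 => [|k _]; first exact: lowered0.
    rewrite /= X_bracket (hwX_gt0 hv) ?linear0 ?add0r ?(hwX_gt0 hv) //; last 2 first.
    + by lia.
    + by lia.
    by rewrite scaler0 add0r ifF ?scaler0 //; apply/negP => /andP[/eqP]; lia.
  move=> i1; have [->|i_neq1] := eqVneq i 1.
    rewrite /dot; under eq_bigr => k _ do rewrite /= (hw_phi hv) scalerA addrA.
    by rewrite -scaler_suml -/(dot (phi Lam : int -> F^o) (m + n) P) hP scale0r; apply: lowered0.
  have -> : i = 0 by lia.
  have -> : dot (fun k => X rho 0 m (X rho (-1) k v)) n P =
      wL Lam (m - 1) *: dot (fun k => X rho (-1) k v) n P
      + (- m)%:~R *: dot (fun k => X rho (-1) k v) (m + n - 1) P.
    rewrite /dot !scaler_sumr -big_split; apply: eq_bigr => k _ /=.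
    rewrite X_bracket (hwX0 hv) linearZZ mul0r subr0 mulrN1 add0r /= addr0 scalerDr.
    rewrite !scalerA; congr (_ *: _ + _); first by rewrite mulrC.
    by rewrite mulrC; congr (_ *: X _ _ _ _); lia.
  by apply: loweredD; apply: loweredZ; apply: lowered_base.
- by rewrite linear0; apply: lowered0.
- by rewrite linearD; apply: loweredD; [apply: IHy|apply: IHz].
- by rewrite linearZZ; apply: loweredZ; apply: IHy.
rewrite /Y X_bracket; apply: loweredD; last first.
  case: ifP => _; last exact: lowered0.
  by rewrite Cop_scalar; do 2!apply: loweredZ.
apply: loweredD; first by apply/loweredY/IHy.
apply: loweredZ; set j := i + _; have [j0|j0] := leP 0 j; first exact: IHy.
have -> : j = - ((absz j).-1.+1)%:Z by lia.
exact: (loweredY ((absz j).-1, _)).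
Qed.

Lemma lowered_weights P x : lowered P x ->
  exists2 u, all (fun t => 0 < wt t.2)%N u & x = ev rho u v.
Proof.
elim=> [m||y z _ [u hu ->] _ [u' hu' ->]|a y _ [u hu ->]|l y _ [u hu ->]].
- exists [seq (P`_k, [:: (0%N, m + k%:Z)]) | k <- iota 0 (size P)].
    by rewrite all_map; apply/allP.
  by rewrite /ev big_map -[size P]subn0 -/(index_iota _ _) big_mkord.
- by exists [::]; rewrite /ev ?big_nil.
- by exists (u ++ u'); rewrite ?all_cat ?hu ?hu' ?ev_cat.
- by exists [seq (a * t.1, t.2) | t <- u]; rewrite ?all_map ?ev_scale.
- by exists [seq (t.1, [:: l] ++ t.2) | t <- u]; rewrite ?all_map ?ev_prefix //; apply/allP.
Qed.

(** By irreducibility [lowered P] is zero or everything; in the latter case [v] would be a sum of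
    terms of negative degree. *)
Lemma recurrent_singular P : (forall n, dot (phi Lam : int -> F^o) n P = 0) ->
  forall m, dot (fun n => X rho (-1) n v) m P = 0.
Proof.
move=> hP.
have hS : submodule rho (lowered P).
  apply: submoduleP => [|i m x hx|x hx].
  - by split; [apply: lowered0|apply: loweredD|apply: loweredZ].
  - have [i0|i0] := leP 0 i; first exact: lowered_X.
    by have -> : i = - ((absz i).-1.+1)%:Z; [lia|exact: (loweredY ((absz i).-1, m))].
  - by rewrite Cop_scalar; apply: loweredZ.
case: Hirr => _ /(_ _ hS) [h m|/(_ v) /lowered_weights [u hu vE]].
  exact/h/lowered_base.
(* The element [u - 1] kills [v], and its degree 0 part is [-1]. *)
have := @ev_homog_eq0 _ charF0 _ _ _ _ hv ((-1, [::]) :: u) _ 0.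
rewrite /homog /= (_ : [seq t <- u | wt t.2 == 0%N] = [::]); last first.
  by apply/eqP; rewrite -[_ == _]negbK -has_filter -all_predC; apply: sub_all hu => t /=; lia.
rewrite /ev big_cons big_seq1 -/(ev rho u v) -vE /= scaleN1r addNr => /(_ erefl).
by move/eqP; rewrite oppr_eq0 (negPf hw_neq0).
Qed.

End IrreducibleSingular.

(** * Finite-dimensional weight spaces *)

Section QuasifiniteConverse.
Variables (F : fieldType) (charF0 : [pchar F] =i pred0) (V : lmodType F) (rho : Bmod V).

(** The bracket coefficient [(m + k) j - i n] is affine in [k], and its linear part differentiates
    [Q]; [i + j != 0] excludes the central term. *)
Lemma dot_bracket i j Q m n z : i + j != 0 ->
  dot (fun k => X rho i k (X rho j n z)) m Q =
    X rho j n (dot (fun k => X rho i k z) m Q)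
    + j%:~R *: dot (fun k => X rho (i + j) k z) (m + n) Q^`()
    + (m * j - i * n)%:~R *: dot (fun k => X rho (i + j) k z) (m + n - 1) Q.
Proof.
move=> ij; rewrite dot_deriv /dot linear_sum !scaler_sumr -!big_split /=.
apply: eq_bigr => k _; rewrite X_bracket linearZZ -addr_eq0 (negPf ij) addr0.
rewrite scalerDr -addrA /=; congr (_ + _).
have -> : m + n + k%:Z - 1 = m + k%:Z + n - 1 by lia.
have -> : m + n - 1 + k%:Z = m + k%:Z + n - 1 by lia.
rewrite !scalerA -scalerDl -mulr_natr; congr (_ *: _).
by rewrite !rmorphB !rmorphM !rmorphD /= -pmulrn; ring.
Qed.

Variables (Lam : weight F) (v : V) (P : {poly F}).
Hypotheses (hv : hw_vector rho Lam v) (P0 : P`_0 != 0).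
Hypothesis hP : forall m, dot (fun n => X rho (-1) n v) m P = 0.

Definition annih (i : int) (e : nat) (z : V) : Prop :=
  forall Q m, P ^+ e %| Q -> dot (fun n => X rho i n z) m Q = 0.

Lemma annih_le i e e' z : (e <= e')%N -> annih i e z -> annih i e' z.
Proof. by move=> h hz Q m hQ; apply: hz; apply: dvdp_trans hQ; apply: dvdp_exp2l. Qed.

(** One power of [P] is lost because the bracket differentiates [Q]. *)
Lemma annih_X i j n e z : i + j != 0 -> annih i e z -> annih (i + j) e z ->
  annih i e.+1 (X rho j n z).
Proof.
move=> ij hi hij Q m hQ.
have hQ' : P ^+ e %| Q by apply: dvdp_trans hQ; apply: dvdp_exp2l.
have hdQ : P ^+ e %| Q^`().
  case/dvdpP: hQ => R ->; rewrite derivM deriv_exp /= exprS dvdp_add //.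
    by rewrite mulrA dvdp_mull.
  by rewrite -mulrnAl mulrA dvdp_mull.
by rewrite dot_bracket // hi // !hij // linear0 !scaler0 !addr0.
Qed.

(* Writing [j = -(a+1)], the bracket [[x^-1 t^i P, x^j t^n Q]] kills [v] for all
   [i], [n]; the difference of its values at [(i, n)] and [(i + 1, n - 1)] is
   [(1 - j) x^(j-1) t^(i+n-1) P Q]. *)
Lemma annih_hw a : annih (- (a.+1)%:Z) a.+1 v.
Proof.
elim: a => [|a IH] Q0 m hQ; first exact: dot_eq0 hQ m.
apply: dot_eq0 hQ m => m; rewrite exprS; set Q := P ^+ a.+1; set j := - (a.+1)%:Z in IH *.
have -> : - (a.+2)%:Z = -1 + j by lia.
have ij : -1 + j != 0 by lia.
pose D i n := dot (fun k => X rho (-1) k (X rho j n v)) i P.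
have D0 i n : dot (D i) n Q = 0.
  rewrite /dot /D; under eq_bigr => l _ do rewrite /dot scaler_sumr.
  rewrite exchange_big big1 // => k _.
  transitivity (P`_k *: X rho (-1) (i + k%:Z) (dot (fun l => X rho j l v) n Q)).
    rewrite /dot linear_sum scaler_sumr; apply: eq_bigr => l _.
    by rewrite /= [X rho _ _ (_ *: _)]linearZZ !scalerA mulrC.
  by rewrite IH ?linear0 ?scaler0.
have Ddiff n : (1 - j)%:~R *: dot (fun k => X rho (-1 + j) k v) n P = D 1 n - D 2 (n - 1).
  rewrite /D !dot_bracket // !hP !linear0 !add0r.
  have -> : 2 + (n - 1) = 1 + n by lia.
  rewrite opprD addrACA subrr add0r -scalerBl -rmorphB.
  have -> : 1 + n - 1 = n by lia.
  by congr (_%:~R *: _); lia.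
have : (1 - j)%:~R *: dot (fun k => X rho (-1 + j) k v) m (P * Q) = 0.
  rewrite dotM scaler_sumr.
  under eq_bigr => l _ do rewrite scalerA mulrC -scalerA Ddiff scalerBr.
  rewrite sumrB -/(dot (D 1) m Q) D0 sub0r.
  have := D0 2 (m - 1); rewrite /dot => h; rewrite -[RHS]oppr0 -[in RHS]h.
  by congr (- _); apply: eq_bigr => l _; rewrite addrAC.
move/eqP; rewrite scaler_eq0 (intr_eq0_char0 charF0) => /orP[|/eqP//].
by rewrite /j; lia.
Qed.

(** A letter [x^-(b+1)] costs one power of [P] for the derivative and raises [a] by [b + 1]; twice
    its weight covers both. *)
Lemma annih_act w a e : (a.+1 + 2 * wt w <= e)%N -> annih (- (a.+1)%:Z) e (act rho w v).
Proof.
elim: w a e => [|x w IH] a e /=.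
  by move=> h; apply: (annih_le _ (@annih_hw a)); lia.
rewrite wt_cons; case: e => [|e] h; first by lia.
apply: annih_X; first by lia.
  by apply: IH; lia.
have -> : - (a.+1)%:Z - (x.1.+1)%:Z = - ((a + x.1).+1.+1)%:Z by lia.
by apply: IH; lia.
Qed.

Definition spanned (l : seq V) (x : V) : Prop :=
  forall S, subspace S -> (forall y, y \in l -> S y) -> S x.

Lemma spanned_fin_dim l (S : V -> Prop) : (forall x, S x -> spanned l x) -> fin_dim S.
Proof.
move=> h; exists (size l), (fun i => l`_i) => x /h hx.
apply: (hx (fun x => exists k : 'I_(size l) -> F, x = \sum_(i < size l) k i *: l`_i)).
  split=> [|_ _ [k ->] [k' ->]|a _ [k ->]].
  - by exists (fun=> 0); rewrite big1 // => i _; rewrite scale0r.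
  - exists (fun i => k i + k' i); rewrite -big_split.
    by apply: eq_bigr => i _; rewrite scalerDl.
  - exists (fun i => a * k i); rewrite scaler_sumr.
    by apply: eq_bigr => i _; rewrite scalerA.
move=> y yl; have yi : (index y l < size l)%N by rewrite index_mem.
exists (fun i => (i == Ordinal yi)%:R).
rewrite (bigD1 (Ordinal yi)) //= eqxx scale1r nth_index // big1 ?addr0 // => i /negPf ->.
by rewrite scale0r.
Qed.

(** Strip the first letter [x^-(a+1) t^m] and expand the rest in the finite list for [n - a - 1]; a
    power of [P] annihilates the resulting sequence in [m], so finitely many [m] suffice. *)
Lemma weight_space_spanned n : exists l : seq V,
  (forall y, y \in l -> exists2 w, wt w = n & y = act rho w v) /\
  (forall w, wt w = n -> spanned l (act rho w v)).
Proof.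
elim/ltn_ind: n => n IHn.
pose spans k l := (forall y, y \in l -> exists2 w, wt w = k & y = act rho w v) /\
    (forall w, wt w = k -> spanned l (act rho w v)).
have [L hL] : {L : nat -> seq V & forall k, (k < n)%N -> spans k (L k)}.
  apply: (@choice _ _ (fun k l => (k < n)%N -> spans k l)) => k; have [kn|_] := ltnP k n; last by exists [::].
  by have [l hl] := IHn _ kn; exists l.
(* On weight [n - a - 1] the exponent in [annih_act] is [(a + 1) + 2 (n - a - 1)], at most [2 n]. *)
pose N := size (P ^+ (2 * n)).
pose B a := [seq X rho (- (a.+1)%:Z) k%:Z y | y <- L (n - a.+1)%N, k <- iota 0 N].
exists ((if n is 0 then [:: v] else [::]) ++ flatten [seq B a | a <- iota 0 n]); split.
  move=> y; rewrite mem_cat => /orP[|/flatten_mapP[a]].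
    by case: {IHn L hL N B} n => // /[!inE] /eqP ->; exists [::].
  rewrite mem_iota => /andP[_ an] /allpairsP[[z k] /= [zL kN ->]].
  have [|h _] := hL (n - a.+1)%N; first by lia.
  have [w ww ->] := h _ zL; exists ((a, k%:Z) :: w) => //.
  by rewrite wt_cons ww /=; lia.
case=> [|[a m] w] ww S hS hl.
  apply: hl; rewrite mem_cat; apply/orP; left.
  by move: ww => /= <-; rewrite inE.
rewrite wt_cons /= in ww.
have [|h1 h2] := hL (n - a.+1)%N; first by lia.
have -> : act rho ((a, m) :: w) v = X rho (- (a.+1)%:Z) m (act rho w v) by [].
apply: (h2 w _ (fun z => S (X rho (- (a.+1)%:Z) m z))); first by lia.
  have [S0 SD SZ] := hS; split=> [|y z hy hz|c y hy]; first by rewrite linear0.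
    by rewrite linearD; apply: SD.
  by rewrite linearZZ; apply: SZ.
move=> y yL; have [w' ww' yE] := h1 _ yL.
apply: (@recurrence_window _ _ (fun k => X rho (- (a.+1)%:Z) k y) (P ^+ (2 * n)) S hS).
- by rewrite -horner_coef0 horner_exp horner_coef0 expf_neq0.
- by move=> k; rewrite yE; apply: annih_act (dvdpp _); lia.
move=> k kN; apply: hl; rewrite mem_cat; apply/orP; right.
apply/flatten_mapP; exists a; first by rewrite mem_iota; lia.
by apply/allpairsP; exists (y, k); rewrite /= mem_iota.
Qed.

Hypothesis gen : generates rho v.

(** The grading is by eigenspaces of [X 0 1], with eigenvalue [wL Lam 0 + a] in degree [a]. *)
Lemma recurrent_quasifinite : quasifinite rho.
Proof.
pose la := wL Lam 0.
pose W (a : int) x := X rho 0 1 x = (la + a%:~R) *: x.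
have WX a b i x : W b x -> W (a + b) (X rho a i x).
  rewrite /W => hx; rewrite grading_op hx linearZZ -scalerDl; congr (_ *: _).
  by rewrite -addrA -rmorphD [b + a]addrC.
have WZ a c x : W a x -> W a (c *: x).
  by rewrite /W => hx; rewrite linearZZ /= hx !scalerA mulrC.
have WD a x y : W a x -> W a y -> W a (x + y).
  by rewrite /W => hx hy; rewrite linearD /= hx hy scalerDr.
have W0 a : W a 0 by rewrite /W linear0 scaler0.
have Whom n u : W (- n%:Z) (ev rho (homog n u) v) by apply: ev_homog_grading.
exists W; split.
- by move=> a; split; [apply: W0|apply: WD|move=> c x; apply: WZ].
- split=> [a b i x hx|b x hx]; last by rewrite (Cop_scalar hv gen); apply: WZ.
  by have := WX a b (i + 1) x hx; rewrite /X addrK.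
- move=> x; have [u ->] := ev_onto hv gen x.
  exists [seq - n%:Z | n <- undup [seq wt t.2 | t <- u]], (fun a => ev rho (homog (absz a) u) v).
  split=> [_ /mapP[n _ ->]|]; first by rewrite abszN absz_nat.
  by rewrite ev_homog big_map; apply: eq_bigr => n _; rewrite abszN absz_nat.
- by move=> s comp us hs h0; exact: (@eigen_indep _ charF0 _ (X rho 0 1) la s comp us hs h0).
move=> a; have [l [_ hl]] := weight_space_spanned (absz a).
apply: (@spanned_fin_dim l) => x hx S hS hlS.
suff [u ->] : exists u, x = ev rho (homog (absz a) u) v.
  rewrite /ev big_filter; apply: subspace_sum => // t /eqP wtt.
  by have [_ _ SZ] := hS; apply: SZ; apply: (hl _ wtt S).
have [u xE] := ev_onto hv gen x.
pose s := [seq - n%:Z | n <- undup [seq wt t.2 | t <- u]].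
have us : uniq s.
  by rewrite map_inj_uniq ?undup_uniq // => p q /eqP; rewrite eqr_opp => /eqP [].
pose g b := ev rho (homog (absz b) u) v.
have xg : x = \sum_(b <- s) g b.
  rewrite xE ev_homog big_map; apply: eq_bigr => n _.
  by rewrite /g abszN absz_nat.
have Wg b : b \in s -> W b (g b).
  by case/mapP => n _ ->; rewrite /g abszN absz_nat.
(* By independence of eigenvectors, [x] is its own component at [a] if [a] occurs in the expansion;
   otherwise, in particular for [a > 0], [x] is 0. *)
have [as_|as_] := boolP (a \in s).
  exists u; apply/eqP; rewrite eq_sym -subr_eq0; apply/eqP.
  have := @eigen_indep _ charF0 _ (X rho 0 1) la s (fun b => g b - (if b == a then x else 0))
    us _ _ a as_.
  rewrite eqxx; apply.
    move=> b /Wg hb; apply: (WD b) => //.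
    by rewrite -scaleN1r; apply: WZ; case: eqP => // ->.
  by rewrite sumrB -xg -big_mkcond -big_filter filter_pred1_uniq // big_seq1 subrr.
exists [::]; rewrite /ev big_nil; apply/eqP; rewrite -oppr_eq0; apply/eqP.
have := @eigen_indep _ charF0 _ (X rho 0 1) la (a :: s) (fun b => if b == a then - x else g b)
  _ _ _ a (mem_head a s).
rewrite eqxx; apply; first by rewrite /= as_.
  move=> b; case: eqP => [->|ba]; first by rewrite -scaleN1r => _; apply: WZ.
  by rewrite inE => /orP[/eqP//|]; apply: Wg.
rewrite big_cons eqxx [X in - X + _]xg addrC; apply/eqP; rewrite subr_eq0; apply/eqP.
rewrite big_seq [RHS]big_seq; apply: eq_bigr => b bs.
by case: eqP => // ba; rewrite -ba bs in as_.
Qed.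

End QuasifiniteConverse.

(** * A nonzero vector in the kernel of the Verma module *)

Section Deformation.
Variables (F : fieldType).
Notation L := (int * int)%type.

(** Structure constants of [B / C], the pair [(i, m)] standing for [x^i t^m]. *)
Definition bcoef (b x : L) : int := b.2 * x.1 - b.1 * x.2.
Definition bsum (b x : L) : L := (b.1 + x.1, b.2 + x.2 - 1).

Lemma bcoefC b x : bcoef x b = - bcoef b x.
Proof. by rewrite /bcoef; ring. Qed.

Lemma bsumC b x : bsum x b = bsum b x.
Proof. by rewrite /bsum; congr pair; lia. Qed.

Lemma bsumA a b c : bsum (bsum a b) c = bsum a (bsum b c).
Proof. by rewrite /bsum /=; congr pair; lia. Qed.

Lemma bcoef_jacobi a b c :
  bcoef b c * bcoef a (bsum b c) = bcoef a b * bcoef (bsum a b) c + bcoef a c * bcoef b (bsum a c).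
Proof. by rewrite /bcoef /bsum /=; ring. Qed.

(* The transpose of the adjoint action of [b] on words, i.e. on the tensor
   algebra of the Lie algebra. *)
Fixpoint ad (b : L) (h : seq L -> F) (w : seq L) : F :=
  if w is x :: w' then (bcoef b x)%:~R * h (bsum b x :: w') + ad b (fun z => h (x :: z)) w'
  else 0.

Lemma ad_ext b h h' w : (forall z, size z = size w -> h z = h' z) -> ad b h w = ad b h' w.
Proof.
elim: w h h' => //= x w IH h h' e; rewrite e //; congr (_ + _).
by apply: IH => z hz; apply: e; rewrite /= hz.
Qed.

Lemma ad_lin b a h h' w : ad b (fun z => a * h z + h' z) w = a * ad b h w + ad b h' w.
Proof. by elim: w h h' => [|x w IH] h h' /=; rewrite ?IH; ring. Qed.

Lemma ad0 b w : ad b (fun=> 0) w = 0.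
Proof. by elim: w => //= x w ->; rewrite mulr0 addr0. Qed.

Lemma ad_bracket b b' h w :
  ad b (ad b' h) w - ad b' (ad b h) w = - ((bcoef b b')%:~R * ad (bsum b b') h w).
Proof.
elim: w h => [|x w IH] h /=; first by rewrite mulr0 subr0 oppr0.
have step c c' : ad c (fun z => (bcoef c' x)%:~R * h (bsum c' x :: z) + ad c' (fun y => h (x :: y)) z) w =
    (bcoef c' x)%:~R * ad c (fun z => h (bsum c' x :: z)) w + ad c (ad c' (fun y => h (x :: y))) w.
  exact: ad_lin.
have alg (k c1 c2 c3 c4 c5 H A A' B B' B'' : F) : B - B' = - (k * B'') ->
    c4 * c5 = k * c1 + c2 * c3 ->
    c2 * (c3 * H + A') + (c4 * A + B) - (c4 * (c5 * H + A) + (c2 * A' + B')) =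
      - (k * (c1 * H + B'')).
  move=> /eqP; rewrite subr_eq => /eqP -> j.
  have -> : c4 * (c5 * H + A) = c4 * c5 * H + c4 * A by ring.
  by rewrite j; ring.
rewrite !step [bsum b' (bsum b x)](_ : _ = bsum b (bsum b' x)); last first.
  by rewrite -!bsumA [bsum b' b]bsumC.
rewrite bsumA; apply: alg; first exact: IH.
by rewrite -!rmorphM -rmorphD bcoef_jacobi.
Qed.

Lemma ad_rcons b h w x : ad b h (rcons w x) =
  ad b (fun z => h (rcons z x)) w + (bcoef b x)%:~R * h (rcons w (bsum b x)).
Proof.
elim: w h => [|y w IH] h /=; first by rewrite addr0 add0r.
by rewrite IH addrA.
Qed.

(** The value of [h] on [w1 (b b' - b' b - [b, b']) w2]; it vanishes identically exactly when [h]
    factors through the enveloping algebra of [B / C]. *)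
Definition defect (h : seq L -> F) w1 b b' w2 : F :=
  h (w1 ++ b :: b' :: w2) - h (w1 ++ b' :: b :: w2) - (bcoef b b')%:~R * h (w1 ++ bsum b b' :: w2).

Lemma ad_defect c h w1 b b' w2 :
  (forall w1' b b' w2', (size w1' + size w2' = size w1 + size w2)%N ->
    defect h w1' b b' w2' = 0) ->
  defect (ad c h) w1 b b' w2 = 0.
Proof.
elim: w1 h => [|x w1 IH] h hh.
  have d z : size z = size w2 -> h (b :: b' :: z) =
      h (b' :: b :: z) + (bcoef b b')%:~R * h (bsum b b' :: z).
    by move=> hz; have /eqP := hh [::] b b' z hz; rewrite /defect subr_eq0 subr_eq addrC => /eqP.
  rewrite /defect /= (@ad_ext c (fun z => h (b :: b' :: z))
    (fun z => (bcoef b b')%:~R * h (bsum b b' :: z) + h (b' :: b :: z))); last first.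
    by move=> z hz; rewrite d // addrC.
  rewrite ad_lin.
  have /eqP := hh [::] (bsum c b) b' w2 erefl; rewrite /defect subr_eq0 subr_eq => /eqP /= ->.
  have /eqP := hh [::] b (bsum c b') w2 erefl; rewrite /defect subr_eq0 subr_eq => /eqP /= ->.
  have -> : bsum b (bsum c b') = bsum c (bsum b b') by rewrite -!bsumA [bsum b c]bsumC.
  rewrite bsumA.
  have alg (k c1 c2 c3 c4 c5 H H1 H2 D1 D2 : F) : k * c1 = c2 * c3 + c4 * c5 ->
      c2 * (c3 * H + H2) + (c4 * (c5 * H + H1) + (k * D1 + D2)) - (c4 * H1 + (c2 * H2 + D2))
      - k * (c1 * H + D1) = 0.
    move=> j; have -> : k * (c1 * H + D1) = k * c1 * H + k * D1 by ring.
    by rewrite j; ring.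
  by apply: alg; rewrite -!rmorphM -rmorphD bcoef_jacobi.
have IHx y : defect (fun z => h (y :: z)) w1 b b' w2 = 0 /\
    defect (ad c (fun z => h (y :: z))) w1 b b' w2 = 0.
  have hh' w1' b1 b1' w2' : (size w1' + size w2' = size w1 + size w2)%N ->
      defect (fun z => h (y :: z)) w1' b1 b1' w2' = 0.
    by move=> hz; apply: (hh (y :: w1')); rewrite /= addSn hz.
  by split; [apply: hh'|apply: IH].
have [h1 _] := IHx (bsum c x); have [_ h2] := IHx x; move: h1 h2.
have alg (k c1 H1 H2 H3 A1 A2 A3 : F) : H1 - H2 - k * H3 = 0 -> A1 - A2 - k * A3 = 0 ->
    (c1 * H1 + A1) - (c1 * H2 + A2) - k * (c1 * H3 + A3) = 0.
  move=> e1 e2; transitivity (c1 * (H1 - H2 - k * H3) + (A1 - A2 - k * A3)); first by ring.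
  by rewrite e1 e2 mulr0 addr0.
exact: alg.
Qed.

(* The functional [d/ds] at [s = 0] of the Harish-Chandra projection
   [U(B) -> U(B_0)] composed with the weight [s f], central charge [0]. *)
Fixpoint eta_rec (f : int -> F) (n : nat) (w : seq L) : F :=
  match n, w with
  | n'.+1, b :: w' =>
      if w' is [::] then (if b.1 == 0 then f b.2 else 0)
      else if 0 < b.1 then ad b (eta_rec f n') w' else 0
  | _, _ => 0
  end.

Variable f : int -> F.

Definition eta (w : seq L) : F := eta_rec f (size w) w.

Lemma eta1 b : eta [:: b] = if b.1 == 0 then f b.2 else 0.
Proof. by []. Qed.

Lemma eta_cons b w : w != [::] -> eta (b :: w) = if 0 < b.1 then ad b eta w else 0.
Proof.
case: w => // x w _; rewrite {1}/eta; set w' := x :: w; rewrite [size _]/=.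
rewrite -[LHS]/(if 0 < b.1 then ad b (eta_rec f (size w')) w' else 0).
by case: ifP => // _; apply: ad_ext => z hz; rewrite /eta hz.
Qed.

(** Behind a common first letter this is [ad_defect]. At the front, two positive letters are settled
    by [ad_bracket], two nonpositive ones make every term vanish, and mixed signs follow from the
    definition of [ad]. *)
Lemma eta_defect w1 b b' w2 : defect eta w1 b b' w2 = 0.
Proof.
have [n] := ubnP (size w1 + size w2); elim: n w1 b b' w2 => // n IH [|c w1] b b' w2 hn.
  rewrite /defect !cat0s (@eta_cons b (b' :: w2)) // (@eta_cons b' (b :: w2)) //=.
  rewrite [bcoef b' b]bcoefC [bsum b' b]bsumC rmorphN mulNr /=.
  set X := _ * eta (bsum b b' :: w2).
  have ad_tail c c' : ad c (fun z => eta (c' :: z)) w2 =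
      if 0 < c'.1 then ad c (ad c' eta) w2 else 0.
    case: w2 {IH hn X} => [|x w2]; first by rewrite /= if_same.
    case: ifP => hc; last rewrite -[RHS](ad0 c (x :: w2)).
      by apply: ad_ext => z hz; rewrite eta_cons ?hc //; case: z hz.
    by apply: ad_ext => z hz; rewrite eta_cons ?hc //; case: z hz.
  rewrite !ad_tail.
  have XE : 0 < b.1 -> 0 < b'.1 -> ad b (ad b' eta) w2 - ad b' (ad b eta) w2 = - X.
    move=> b0 b'0; rewrite ad_bracket /X; congr (- (_ * _)).
    case: w2 {IH hn X ad_tail} => [|x w2]; first by rewrite eta1 /= ifF //; lia.
    by rewrite eta_cons //= ifT //; lia.
  have X0 : b.1 <= 0 -> b'.1 <= 0 -> X = 0.
    move=> b0 b'0; rewrite /X; case: w2 {IH hn X ad_tail XE} => [|x w2].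
      rewrite eta1 /=; case: eqP => bb; last by rewrite mulr0.
      rewrite (_ : bcoef b b' = 0) ?mul0r //.
      by rewrite /bcoef; have [-> ->] : b.1 = 0 /\ b'.1 = 0; [lia|rewrite mulr0 mul0r subr0].
    by rewrite eta_cons //= ifF ?mulr0 //; lia.
  move: XE X0; case: (ltP 0 b.1) => b0; case: (ltP 0 b'.1) => b'0 XE X0.
  - move/eqP: (XE isT isT); rewrite subr_eq => /eqP ->; rewrite /X; ring.
  - by rewrite /X; ring.
  - by rewrite /X; ring.
  - by rewrite X0 // subrr subr0.
rewrite /defect !cat_cons !eta_cons; try by case: (w1).
case: ifP => _; last by rewrite mulr0 !subr0.
apply: ad_defect => w1' b1 b1' w2' hz; apply: IH.
by rewrite hz; move: hn; rewrite /= addSn ltnS.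
Qed.

(** A positive [c] acting by [ad] leaves the last letter alone or makes its degree positive, so
    induction applies. This makes [twisted] a highest weight vector. *)
Lemma eta_rcons w b : (0 < b.1) || (b.1 == 0) && (w != [::]) -> eta (rcons w b) = 0.
Proof.
have [n] := ubnP (size w); elim: n w b => // n IH [|c w] b hn hb.
  by rewrite eta1 ifF //; move: hb; rewrite /= andbF orbF; lia.
rewrite rcons_cons eta_cons; last by case: (w).
case: ifP => // c0; have b0 : 0 < (bsum c b).1.
  by case/orP: hb => [b0|/andP[/eqP b0 _]] /=; [rewrite addr_gt0|rewrite b0 addr0].
rewrite ad_rcons (IH _ (bsum c b)) ?b0 // mulr0 addr0.
case: w hn hb => // x w hn hb; rewrite -[RHS](ad0 c (x :: w)).
apply: ad_ext => z hz; apply: IH; first by rewrite hz.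
by case: z hz => //= y z _; lia.
Qed.

End Deformation.

(** * The module of functions on the enveloping algebra *)

Section Extension.
Variables (F : fieldType) (V : lmodType F).
Notation L := (int * int)%type.

Definition respects_bracket (h : seq L -> V) : Prop := forall w1 b b' w2,
  h (w1 ++ b :: b' :: w2) - h (w1 ++ b' :: b :: w2) =
    (bcoef b b')%:~R *: h (w1 ++ bsum b b' :: w2).

(* [Hom(U(B / C), V)], realized as the functions on words in the [x^i t^m] that
   are compatible with the bracket. *)
Definition extension_pred : {pred seq L -> V} := [pred h | `[< respects_bracket h >]].

Lemma extension_closed : submod_closed extension_pred.
Proof.
split=> [|a h h' /asboolP hh /asboolP hh']; apply/asboolP => w1 b b' w2.
  by rewrite subrr scaler0.
rewrite -[LHS]/(a *: h _ + h' _ - (a *: h _ + h' _)).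
rewrite -[in RHS]/(a *: h _ + h' _).
by rewrite opprD addrACA -scalerBr hh hh' scalerDr !scalerA mulrC.
Qed.

HB.instance Definition _ := GRing.isSubmodClosed.Build F (seq L -> V) extension_pred
  (GRing.submod_closed_semi extension_closed).

Record extension := Extension { ext_fun : seq L -> V; _ : ext_fun \in extension_pred }.
HB.instance Definition _ := [isSub for ext_fun].
HB.instance Definition _ := [Choice of extension by <:].
HB.instance Definition _ := [SubChoice_isSubLmodule of extension by <:].

Lemma extensionP (h : extension) : respects_bracket (ext_fun h).
Proof. by case: h => h /= /asboolP. Qed.

Lemma ext_eq (h h' : extension) : ext_fun h =1 ext_fun h' -> h = h'.
Proof. by move=> e; apply: val_inj; apply: funext. Qed.

Lemma ext_lin a (h h' : extension) w : ext_fun (a *: h + h') w = a *: ext_fun h w + ext_fun h' w.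
Proof. by []. Qed.

Definition ext_at w (h : extension) : V := ext_fun h w.

HB.instance Definition _ w :=
  GRing.isLinear.Build F extension V *:%R (ext_at w) (fun a h h' => ext_lin a h h' w).

Lemma ext_scale a (h : extension) w : ext_fun (a *: h) w = a *: ext_fun h w.
Proof. by []. Qed.

Lemma ext_sub (h h' : extension) w : ext_fun (h - h') w = ext_fun h w - ext_fun h' w.
Proof. by []. Qed.

Variable rho : Bmod V.

(** The operator adds right translation of [h] to the action on values. *)
Lemma ext_Lop_subproof i j (h : extension) :
  (fun w => Lop rho i j (ext_fun h w) + ext_fun h (rcons w (i, j + 1))) \in extension_pred.
Proof.
apply/asboolP => w1 b b' w2; rewrite opprD addrACA -linearB extensionP linearZZ scalerDr.
by congr (_ + _); rewrite !rcons_cat /= extensionP.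
Qed.

Definition ext_Lop i j h := Extension (ext_Lop_subproof i j h).

Lemma ext_Cop_subproof (h : extension) : (fun w => Cop rho (ext_fun h w)) \in extension_pred.
Proof. by apply/asboolP => w1 b b' w2; rewrite -linearB extensionP linearZZ. Qed.

Definition ext_Cop h := Extension (ext_Cop_subproof h).

Lemma ext_LopE i j h w :
  ext_fun (ext_Lop i j h) w = Lop rho i j (ext_fun h w) + ext_fun h (rcons w (i, j + 1)).
Proof. by []. Qed.

Lemma ext_CopE h w : ext_fun (ext_Cop h) w = Cop rho (ext_fun h w).
Proof. by []. Qed.

Lemma ext_Lop_linear i j a h h' :
  ext_Lop i j (a *: h + h') = a *: ext_Lop i j h + ext_Lop i j h'.
Proof.
by apply: ext_eq => w; rewrite ext_lin !ext_LopE !ext_lin linearP /= addrACA -scalerDr.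
Qed.

Lemma ext_Cop_linear a h h' : ext_Cop (a *: h + h') = a *: ext_Cop h + ext_Cop h'.
Proof. by apply: ext_eq => w; rewrite ext_lin !ext_CopE !ext_lin linearP. Qed.

Lemma ext_LL_bracket i j k l h :
  ext_Lop i j (ext_Lop k l h) - ext_Lop k l (ext_Lop i j h) =
    ((j + 1) * k - i * (l + 1))%:~R *: ext_Lop (i + k) (j + l) h
    + (if (i == - k) && (j + l == -2) then i%:~R *: ext_Cop h else 0).
Proof.
apply: ext_eq => w; rewrite ext_sub ext_lin !ext_LopE !linearD /=.
have -> : ext_fun (if (i == - k) && (j + l == -2) then i%:~R *: ext_Cop h else 0) w =
    if (i == - k) && (j + l == -2) then i%:~R *: Cop rho (ext_fun h w) else 0.
  by case: ifP.
have := extensionP h w (i, j + 1) (k, l + 1) [::].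
rewrite /bcoef /bsum /= -!cat_rcons !cats0.
have -> : j + 1 + (l + 1) - 1 = j + l + 1 by lia.
have := LL_bracket rho i j k l (ext_fun h w).
set c := _%:~R; set K := if _ then _ else _.
move: (Lop rho i j (Lop rho k l _)) (Lop rho k l (Lop rho i j _)) => A A'.
move: (Lop rho i j _) (Lop rho k l _) (ext_fun h (rcons (rcons _ _) _)) => B B'.
move: (ext_fun h (rcons (rcons _ _) _)) => C C' e1 e2.
rewrite [RHS]addrAC -e1 -e2 (AC ((2*2)*(2*2)) ((1*5)*(4*8)*((2*7)*(3*6)))) /=.
by rewrite !subrr !addr0.
Qed.

Lemma ext_CL_bracket i j h : ext_Cop (ext_Lop i j h) - ext_Lop i j (ext_Cop h) = 0.
Proof.
apply: ext_eq => w; rewrite ext_sub !(ext_CopE, ext_LopE) linearD /=.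
by rewrite opprD addrACA CL_bracket subrr addr0.
Qed.

Definition ext_Bmod : Bmod extension :=
  Build_Bmod ext_Lop_linear ext_Cop_linear ext_LL_bracket ext_CL_bracket.

Lemma ext_X i m h w :
  ext_fun (X ext_Bmod i m h) w = X rho i m (ext_fun h w) + ext_fun h (rcons w (i, m)).
Proof. by rewrite /X ext_LopE subrK. Qed.

End Extension.

Lemma hom_dot (F : fieldType) (M V : lmodType F) (rhoM : Bmod M) (rho : Bmod V) (f : M -> V)
  (s : int -> M) m P : is_hom rhoM rho f -> f (dot s m P) = dot (fun n => f (s n)) m P.
Proof.
case=> lf _ _; pose fl : {linear M -> V} :=
  HB.pack f (GRing.isLinear.Build F M V *:%R f lf).
by rewrite -[f]/(fl : M -> V) (dot_linear fl).
Qed.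

Lemma hom_X (F : fieldType) (M V : lmodType F) (rhoM : Bmod M) (rho : Bmod V) (f : M -> V)
  i m x : is_hom rhoM rho f -> f (X rhoM i m x) = X rho i m (f x).
Proof. by case=> _ h _; apply: h. Qed.

Section VermaNotFree.
Variables (F : fieldType) (V : lmodType F) (rho : Bmod V) (Lam : weight F) (v : V).
Hypotheses (hv : hw_vector rho Lam v) (v0 : v != 0).

Let delta0 (n : int) : F := (n == 0)%:R.

(** The left translate of [eta] by [x t], with values on the line of [v]; left translation preserves
    compatibility with the bracket. *)
Lemma twisted_subproof : (fun w => eta delta0 ((1, 1) :: w) *: v) \in @extension_pred F V.
Proof.
apply/asboolP => w1 b b' w2; rewrite -scalerBl scalerA; congr (_ *: _).
by have /eqP := eta_defect delta0 ((1, 1) :: w1) b b' w2; rewrite subr_eq0 => /eqP.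
Qed.

Definition twisted : extension V := Extension twisted_subproof.

Lemma hw_twisted : hw_vector (ext_Bmod rho) Lam twisted.
Proof.
have key (b : int * int) w : 0 <= b.1 -> eta delta0 ((1, 1) :: rcons w b) = 0.
  move=> b0; rewrite -rcons_cons eta_rcons //= andbT.
  by rewrite orbC eq_sym -le_eqVlt.
split.
- move=> a i a0; apply: ext_eq => w; rewrite ext_LopE /= key ?scale0r ?addr0 //; last exact: ltW.
  by rewrite linearZZ /=; case: hv => -> // _ _; rewrite scaler0.
- move=> i; apply: ext_eq => w; rewrite ext_scale ext_LopE /= key // scale0r addr0.
  by rewrite linearZZ /=; case: hv => _ -> _; rewrite !scalerA mulrC.
- apply: ext_eq => w; rewrite ext_scale ext_CopE /= linearZZ /=.
  by case: hv => _ _ ->; rewrite !scalerA mulrC.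
Qed.

(** At the empty word, [x^-1 t^k] sends [twisted] to [-v] if [k = 0] and to 0 otherwise, so [x^-1 P]
    yields [v] times minus the constant coefficient of [P]. *)
Lemma twisted_lowered (P : {poly F}) : P`_0 != 0 ->
  (forall m, dot (fun n => X rho (-1) n v) m P = 0) ->
  dot (fun n => X (ext_Bmod rho) (-1) n twisted) 0 P != 0.
Proof.
move=> P0 hP; apply/eqP => /(congr1 (fun h : extension V => ext_fun h [::])).
rewrite -[LHS]/(ext_at [::] _) -dot_linear.
rewrite /dot (eq_bigr (fun k : 'I_(size P) => - (P`_k * (k == 0%N :> nat)%:R) *: v)).
  rewrite -scaler_suml => /eqP; rewrite scaler_eq0 (negPf v0) orbF sumrN oppr_eq0.
  have sP : (0 < size P)%N by rewrite lt0n size_poly_eq0; apply: contraNneq P0 => ->; rewrite coef0.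
  rewrite (bigD1 (Ordinal sP)) //= mulr1 big1 ?addr0 ?(negPf P0) // => k /negPf k0.
  by rewrite (_ : (k == 0%N :> nat) = false) ?mulr0 // -k0.
move=> k _; rewrite -[GRing.Linear.sort _ _]/(ext_fun (X (ext_Bmod rho) (-1) (0 + k%:Z) twisted) [::]) ext_X /= eta1 linearZZ scale0r add0r eta_cons //=.
rewrite addr0 eta1 /= scalerA; congr (_ *: _).
have -> : delta0 (1 + (0 + k%:Z) - 1) = (k == 0%N :> nat)%:R.
  by rewrite /delta0; congr (nat_of_bool _)%:R; lia.
case: eqP => [->|_]; last by rewrite !mulr0 oppr0.
by rewrite /bcoef /=; ring.
Qed.

End VermaNotFree.

(** * From a recurrence to a proper quotient *)

Section RecurrentQuotient.
Variables (F : fieldType) (charF0 : [pchar F] =i pred0) (V : lmodType F) (rho : Bmod V).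
Variables (Lam : weight F) (v : V).
Hypotheses (Hirr : irreducible rho) (hv : hw_vector rho Lam v) (gen : generates rho v).

Lemma hom_onto (M : lmodType F) (rhoM : Bmod M) (m : M) (f : M -> V) :
  is_hom rhoM rho f -> f m = v -> forall y, exists x, f x = y.
Proof.
move=> hf fm; have [lf fL fC] := hf; apply: gen; last by exists m.
have f0 : f 0 = 0 by have := lf (-1) 0 0; rewrite scaler0 addr0 scaleN1r addNr.
split; first split.
- by exists 0.
- by move=> _ _ [x <-] [y <-]; exists (1 *: x + y); rewrite lf scale1r.
- by move=> a _ [x <-]; exists (a *: x + 0); rewrite lf f0 addr0.
- by move=> i j _ [x <-]; exists (Lop rhoM i j x).
- by move=> _ [x <-]; exists (Cop rhoM x).
Qed.

Lemma recurrent_proper_quotient : recurrent Lam -> proper_Verma_quotient rho Lam.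
Proof.
move=> /recurrent_dot [P P0 hP] M rhoM m [_ _ univ].
have [[f [hf fm]] _] := univ _ _ _ hv; exists f; split=> //; first exact: hom_onto hf fm.
have hsing := recurrent_singular charF0 Hirr hv gen hP.
exists (dot (fun n => X rhoM (-1) n m) 0 P); split; last first.
  by rewrite (hom_dot _ _ _ hf) -[RHS](hsing 0) -fm; apply: eq_bigr => k _; rewrite (hom_X _ _ _ hf).
have [[g [hg gm]] _] := univ _ _ _ (hw_twisted hv).
have tw := twisted_lowered (hw_neq0 Hirr hv gen) P0 hsing.
apply: contraNneq tw => x0.
have := hom_dot (fun n => X rhoM (-1) n m) 0 P hg; rewrite x0.
have [lg _ _] := hg.
have -> : g 0 = 0 by have := lg (-1) 0 0; rewrite scaler0 addr0 scaleN1r addNr.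
move=> e; rewrite e; apply/eqP; apply: eq_bigr => k _.
by rewrite (hom_X _ _ _ hg) gm.
Qed.

End RecurrentQuotient.

(** * The symbol of an annihilating element *)

Section Lowering.
Variables (F : fieldType) (V : lmodType F) (rho : Bmod V) (Lam : weight F) (v : V).
Hypothesis hv : hw_vector rho Lam v.

(* Applying [x t^k] to [act w v] gives words in which one letter [x^-(b+1) t^(r+k)]
   moves with [k], with coefficients polynomial in [k], and words not
   depending on [k], with coefficients values of [phi]. *)
Definition moving1 (t : word * (nat * int) * word) :
    seq ({poly F} * (nat * int) * word * word) :=
  let: (p, (a, m), s) := t in
  if a is a'.+1 then [:: (- ((a'.+2)%:R *: 'X + m%:~R%:P), (a', m - 1), p, s)]
  else [seq ((r.1.2.1.+1)%:R *: (('X + m%:~R%:P) * ('X + (m - 1)%:~R%:P)),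
             (r.1.2.1, r.1.2.2 + m - 2), p ++ r.1.1, r.2) | r <- splits s].

Definition fixed1 (t : word * (nat * int) * word) : seq (int * word) :=
  let: (p, (a, m), s) := t in if a is 0 then [:: (m, p ++ s)] else [::].

Definition moving w := flatten [seq moving1 t | t <- splits w].
Definition fixed w := flatten [seq fixed1 t | t <- splits w].

Lemma X0_act q w : X rho 0 q (act rho w v) = wL Lam (q - 1) *: act rho w v +
  \sum_(r <- splits w) - (q * (r.1.2.1.+1)%:Z)%:~R *:
    act rho (r.1.1 ++ (r.1.2.1, r.1.2.2 + q - 1) :: r.2) v.
Proof.
rewrite (@act_commutator _ _ rho (X rho 0 q)) /= (hwX0 hv) linearZZ; congr (_ + _).
apply: eq_bigr => -[[p [b m]] s] _ /=.
rewrite /Y X_commutator mul0r subr0 add0r.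
rewrite (linearD (act rho p)) /= linearZZ act_cat act_cons /Y /= mulrN rmorphN [m + q]addrC.
by rewrite linear0 addr0.
Qed.

Lemma X1_letter k a m z :
  X rho 1 k (Y rho (a, m) z) - Y rho (a, m) (X rho 1 k z) =
    - (k * (a.+1)%:Z + m)%:~R *: X rho (- a%:Z) (k + m - 1) z
    + (if (a == 0%N) && (k + m == 0) then Cop rho z else 0).
Proof.
rewrite /Y X_commutator /=.
have -> : 1 - (a.+1)%:Z = - a%:Z by lia.
have -> : k * - (a.+1)%:Z - 1 * m = - (k * (a.+1)%:Z + m) by lia.
have -> : (1 == - - (a.+1)%:Z) = (a == 0%N) by lia.
by rewrite rmorphN /= scale1r.
Qed.

(** For [a > 0] the bracket is a multiple of one letter. For [a = 0] it is a multiple of [t^(k+m-1)]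
    plus a central term: its eigenvalue on [v] combines with [C] into [phi], and its brackets with
    the suffix are the moving terms. *)
Lemma lower_letter k t :
  act rho t.1.1 (X rho 1 k (Y rho t.1.2 (act rho t.2 v)) - Y rho t.1.2 (X rho 1 k (act rho t.2 v)))
  = \sum_(r <- moving1 t) r.1.1.1.[k%:~R] *: act rho (r.1.2 ++ (r.1.1.2.1, r.1.1.2.2 + k) :: r.2) v
    + \sum_(r <- fixed1 t) phi Lam (k + r.1) *: act rho r.2 v.
Proof.
case: t => [[p [[|a] m]] s] /=; rewrite X1_letter /=; last first.
  rewrite big_nil big_seq1 /= !addr0 linearZZ act_cat act_cons; congr (_ *: act _ _ _).
    rewrite hornerN hornerD hornerZ hornerX hornerC.
    by rewrite rmorphD rmorphM /= -pmulrn mulrC.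
  by rewrite /Y /=; congr (X _ _ _ _); lia.
rewrite big_seq1 /= big_map oppr0 X0_act Cop_act (hwC hv) (linearD (act rho p)) linearZZ (linearD (act rho p)) /=.
have -> : act rho p (if k + m == 0 then act rho s (wc Lam *: v) else 0) =
    (if k + m == 0 then wc Lam else 0) *: act rho (p ++ s) v.
  by case: eqP => _; rewrite ?linear0 ?scale0r // (linearZZ (act rho s)) (linearZZ (act rho p)) /= -act_cat.
rewrite (linearZZ (act rho p)) (linear_sum (act rho p)) /= -act_cat /phi [in RHS]scalerDl.
rewrite scalerDr scalerA addrAC addrC; congr (_ + (_ *: _ + _)); last first.
  by rewrite mulr1 mulNr; congr (- (_ * wL _ _)); lia.
rewrite scaler_sumr; apply: eq_bigr => r _ /=.
rewrite (linearZZ (act rho p)) /= scalerA -act_cat catA mulr1; congr (_ *: act _ (_ ++ (_, _) :: _) _); last by lia.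
rewrite hornerZ hornerM !hornerD hornerX !hornerC mulrNN mulrC.
by rewrite !rmorphM !rmorphB !rmorphD /= -pmulrn; ring.
Qed.

Lemma X1_act k w : X rho 1 k (act rho w v) =
  \sum_(r <- moving w) r.1.1.1.[k%:~R] *: act rho (r.1.2 ++ (r.1.1.2.1, r.1.1.2.2 + k) :: r.2) v
  + \sum_(r <- fixed w) phi Lam (k + r.1) *: act rho r.2 v.
Proof.
rewrite (@act_commutator _ _ rho (X rho 1 k)) /= (hwX_gt0 hv) // linear0 add0r.
rewrite (eq_bigr _ (fun t _ => lower_letter k t)) big_split !big_flatten !big_map.
by [].
Qed.

Definition movingu (u : seq (F * word)) : seq ({poly F} * (nat * int) * word * word) :=
  flatten [seq [seq (t.1 *: r.1.1.1, r.1.1.2, r.1.2, r.2) | r <- moving t.2] | t <- u].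
Definition fixedu (u : seq (F * word)) : seq (F * int * word) :=
  flatten [seq [seq (t.1, r.1, r.2) | r <- fixed t.2] | t <- u].
Definition lower (k : int) (u : seq (F * word)) : seq (F * word) :=
  [seq (r.1.1.1.[k%:~R], r.1.2 ++ (r.1.1.2.1, r.1.1.2.2 + k) :: r.2) | r <- movingu u] ++
  [seq (r.1.1 * phi Lam (k + r.1.2), r.2) | r <- fixedu u].

Lemma ev_lower k u : ev rho (lower k u) v = X rho 1 k (ev rho u v).
Proof.
rewrite ev_cat /ev !big_map !big_flatten !big_map linear_sum -big_split.
apply: eq_bigr => t _ /=; rewrite !big_map /= (linearZZ (X rho 1 k)) /= X1_act scalerDr !scaler_sumr.
by congr (_ + _); apply: eq_bigr => r _ /=; rewrite ?hornerZ scalerA.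
Qed.

Lemma moving_wt w r : r \in moving w -> (wt (r.1.2 ++ r.1.1.2 :: r.2)).+1 = wt w.
Proof.
case/flatten_mapP => [[[p [[|a] m]] s]] /splits_cat_cons /= ->.
  case/mapP => [[[p' [b m']] s']] /splits_cat_cons /= -> -> /=.
  by rewrite !wt_cat !wt_cons !wt_cat !wt_cons /=; lia.
by rewrite inE => /eqP -> /=; rewrite !wt_cat !wt_cons /=; lia.
Qed.

Lemma fixed_wt w r : r \in fixed w -> (wt r.2).+1 = wt w.
Proof.
case/flatten_mapP => [[[p [[|a] m]] s]] /splits_cat_cons /= -> //.
by rewrite inE => /eqP -> /=; rewrite !wt_cat !wt_cons /=; lia.
Qed.

Lemma moving_size w r : r \in moving w -> (size (r.1.2 ++ r.1.1.2 :: r.2) <= size w)%N.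
Proof.
case/flatten_mapP => [[[p [[|a] m]] s]] /splits_cat_cons /= ->.
  case/mapP => [[[p' [b m']] s']] /splits_cat_cons /= -> -> /=.
  by rewrite !size_cat /= !size_cat /=; lia.
by rewrite inE => /eqP -> /=; rewrite !size_cat /=; lia.
Qed.

Lemma fixed_size w r : r \in fixed w -> (size r.2 <= size w)%N.
Proof.
case/flatten_mapP => [[[p [[|a] m]] s]] /splits_cat_cons /= -> //.
by rewrite inE => /eqP -> /=; rewrite !size_cat /=; lia.
Qed.

Lemma lower_wt k n u : (forall t, t \in u -> wt t.2 = n.+1) ->
  forall t, t \in lower k u -> wt t.2 = n.
Proof.
move=> hu t; rewrite mem_cat => /orP[] /mapP[r /flatten_mapP[t0 t0u /mapP[r0 r0m -> ->]]] /=.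
  have := moving_wt r0m; rewrite (hu _ t0u) => -[<-].
  by rewrite !wt_cat !wt_cons.
by have := fixed_wt r0m; rewrite (hu _ t0u) => -[<-].
Qed.

Lemma lower_size k n u : (forall t, t \in u -> (size t.2 <= n)%N) ->
  forall t, t \in lower k u -> (size t.2 <= n)%N.
Proof.
move=> hu t; rewrite mem_cat => /orP[] /mapP[r /flatten_mapP[t0 t0u /mapP[r0 r0m -> ->]]] /=.
  by apply: leq_trans (hu _ t0u); have := moving_size r0m; rewrite !size_cat.
by apply: leq_trans (hu _ t0u); apply: fixed_size.
Qed.

End Lowering.

(** * Separation of terms and coefficients of symbols *)

Section Symbols.
Variables (F : fieldType) (charF0 : [pchar F] =i pred0).

Lemma poly_int_roots (Q : {poly F}) (K : int) :
  (forall k : int, K <= k -> Q.[k%:~R] = 0) -> Q = 0.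
Proof.
move=> hQ; pose rs := [seq (K + i%:Z)%:~R : F | i <- iota 0 (size Q)].
apply: (@roots_geq_poly_eq0 _ _ rs); last by rewrite size_map size_iota.
  by apply/allP => _ /mapP[i _ ->]; apply/eqP/hQ; lia.
rewrite map_inj_uniq ?iota_uniq // => i j /eqP.
rewrite -subr_eq0 -rmorphB (intr_eq0_char0 charF0) => /eqP; lia.
Qed.

Lemma bounded_letters (s : word) : exists B : nat, forall x, x \in s -> (absz x.2 <= B)%N.
Proof.
elim: s => [|x s [B hB]]; first by exists 0%N.
exists (maxn B (absz x.2)) => y; rewrite inE leq_max => /orP[/eqP ->|/hB ->//].
by rewrite leqnn orbT.
Qed.

Lemma perm_eq_consE (T : eqType) (x : T) s t :
  perm_eq (x :: s) t = (x \in t) && perm_eq s (rem x t).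
Proof.
apply/idP/andP => [h|[xt h]].
  have xt : x \in t by rewrite -(perm_mem h) mem_head.
  by split=> //; rewrite -(perm_cons x) (perm_trans h) // perm_to_rem.
by apply: perm_trans (_ : perm_eq (x :: rem x t) t); rewrite ?perm_cons // perm_sym perm_to_rem.
Qed.

Definition shift (k : int) (l : nat * int) : nat * int := (l.1, l.2 + k).

(* For large [k] the moving letter exceeds all other letters, so that terms of
   different type cannot cancel: the polynomial attached to each type vanishes
   at all large integers, hence identically. *)
Lemma moving_fixed_separate (mv : seq ({poly F} * (nat * int) * word))
    (fx : seq ((int -> F) * word)) (n : nat) :
  (forall k mu, size mu = n ->
    \sum_(r <- mv | perm_eq (shift k r.1.2 :: r.2) mu) r.1.1.[k%:~R]
    + \sum_(s <- fx | perm_eq s.2 mu) s.1 k = 0) ->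
  (forall (l : nat * int) nu, (size nu).+1 = n ->
    \sum_(r <- mv | (r.1.2 == l) && perm_eq r.2 nu) r.1.1 = 0) /\
  (forall k mu, size mu = n -> \sum_(s <- fx | perm_eq s.2 mu) s.1 k = 0).
Proof.
move=> h.
have part1 (l : nat * int) nu : (size nu).+1 = n ->
    \sum_(r <- mv | (r.1.2 == l) && perm_eq r.2 nu) r.1.1 = 0.
  move=> hnu.
  have [B hB] := bounded_letters (l :: nu ++ flatten [seq r.1.2 :: r.2 | r <- mv]
    ++ flatten [seq s.2 | s <- fx]).
  have Bl : (absz l.2 <= B)%N by apply: hB; rewrite mem_head.
  have Bmv r x : r \in mv -> x \in r.1.2 :: r.2 -> (absz x.2 <= B)%N.
    move=> rmv xr; apply: hB; rewrite inE !mem_cat.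
    by have -> : x \in flatten [seq r.1.2 :: r.2 | r <- mv];
      [apply/flatten_mapP; exists r|rewrite ?orbT].
  have Bfx s x : s \in fx -> x \in s.2 -> (absz x.2 <= B)%N.
    move=> sfx xs; apply: hB; rewrite inE !mem_cat.
    by have -> : x \in flatten [seq s.2 | s <- fx];
      [apply/flatten_mapP; exists s|rewrite ?orbT].
  apply: (@poly_int_roots _ (2 * B + 1)%N%:Z) => k hk.
  have far : ~ (absz (l.2 + k)%R <= B)%N by move: (l.2 : int) hk Bl => z; lia.
  have := h k (shift k l :: nu) hnu.
  rewrite [X in _ + X]big_seq_cond [X in _ + X]big_pred0 ?addr0 => [|s]; last first.
    apply/negbTE/negP => /andP[sfx hp].
    have : shift k l \in s.2 by rewrite (perm_mem hp) mem_head.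
    by move=> /(Bfx _ _ sfx); apply: far.
  rewrite horner_sum => hk0; rewrite -[RHS]hk0 big_seq_cond [RHS]big_seq_cond; apply: eq_bigl => r.
  have [rmv|//] := boolP (r \in mv); rewrite /=.
  have Br := Bmv r _ rmv.
  apply/andP/idP => [[/eqP -> hp]|hp]; first by rewrite perm_cons.
  have : shift k l \in shift k r.1.2 :: r.2 by rewrite (perm_mem hp) mem_head.
  rewrite inE => /orP[/eqP e|lr]; last first.
    by have := Br _ (mem_behead (s := r.1.2 :: r.2) lr); move/far.
  have <- : l = r.1.2.
    case: e; case: (l) (r.1.2) => [a m] [b m'] /= -> e; congr pair; lia.
  by move: hp; rewrite -e perm_cons eqxx.
(* Grouped by moving letter, the moving terms cancel by [part1], leaving the fixed ones. *)
split=> // k mu hmu; rewrite -[RHS](h k mu hmu) -[LHS]add0r; congr (_ + _).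
rewrite -big_filter (sum_by_key (fun r => shift k r.1.2)) big_seq big1 // => y.
rewrite mem_undup => /mapP[r0]; rewrite mem_filter => /andP[hp _] ->.
set y0 := shift k _ in hp *.
have ymu : y0 \in mu by rewrite -(perm_mem hp) mem_head.
rewrite big_filter_cond.
have hs : (size (rem y0 mu)).+1 = n.
  by rewrite size_rem // prednK // -has_predT; apply/hasP; exists y0.
rewrite -[RHS](horner0 (k%:~R)) -(part1 r0.1.2 _ hs) horner_sum; apply: eq_bigl => r.
rewrite perm_eq_consE; have -> : (shift k r.1.2 == y0) = (r.1.2 == r0.1.2).
  rewrite /y0; apply/eqP/eqP => [|-> //].
  by case: (r.1.2) (r0.1.2) => [a m] [b m'] [-> e]; congr pair; lia.
by case: eqP => [e|]; rewrite ?andbF // [shift k r.1.2](_ : _ = y0) ?ymu ?andbT // /y0 e.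
Qed.

(** With words up to permutation as monomials, this is [c] times the coefficient of [nu] in the
    partial derivative of [w] with respect to [l]. *)
Lemma count_splits (V : nmodType) (w nu : word) l (c : V) :
  \sum_(t <- splits w | (t.1.2 == l) && perm_eq (t.1.1 ++ t.2) nu) c =
    if perm_eq w (l :: nu) then c *+ count_mem l w else 0.
Proof.
have e : forall t, t \in splits w ->
    (t.1.2 == l) && perm_eq (t.1.1 ++ t.2) nu = (t.1.2 == l) && perm_eq w (l :: nu).
  move=> t /splits_cat_cons wE; case: eqP => //= tl.
  by rewrite [in RHS]wE tl -cat_rcons -cats1 -catA perm_catCA perm_cons.
rewrite big_seq_cond (eq_bigl (fun t => (t \in splits w) && ((t.1.2 == l) && perm_eq w (l :: nu)))).
  rewrite -big_seq_cond; case: ifP => hw; last by rewrite big_pred0 // => t; rewrite andbF.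
  under eq_bigl do rewrite andbT.
  by rewrite -(big_map (fun t => t.1.2) (pred1 l) (fun=> c)) letters_splits big_const_seq iter_addr_0.
by move=> t; case: (boolP (t \in splits w)) => //= /e.
Qed.

(** The coefficient of the monomial [mu] in the symmetric-algebra image of [u]. *)
Definition cf (u : seq (F * word)) (mu : word) : F := \sum_(t <- u | perm_eq t.2 mu) t.1.

End Symbols.

Lemma perm_eq_mid (T : eqType) (p s : seq T) x : perm_eq (p ++ x :: s) =1 perm_eq (x :: p ++ s).
Proof. by apply/permPl; rewrite -cat1s perm_catCA. Qed.

Section SymbolVanishing.
Variables (F : fieldType) (charF0 : [pchar F] =i pred0) (V : lmodType F) (rho : Bmod V).
Variables (Lam : weight F) (v : V).
Hypotheses (hv : hw_vector rho Lam v) (v0 : v != 0).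

Lemma cf_lower k u mu : cf (lower Lam k u) mu =
  \sum_(r <- [seq (r.1.1.1, r.1.1.2, r.1.2 ++ r.2) | r <- movingu u] |
      perm_eq (shift k r.1.2 :: r.2) mu) r.1.1.[k%:~R]
  + \sum_(s <- [seq (fun k => r.1.1 * phi Lam (k + r.1.2), r.2) | r <- fixedu u] |
      perm_eq s.2 mu) s.1 k.
Proof.
rewrite /cf big_cat /= !big_map; congr (_ + _); apply: eq_bigl => r /=.
by rewrite perm_eq_mid.
Qed.

(** A moving term coming from a letter of degree -1 is shorter than [w], hence too short to match;
    lower letters contribute by a partial derivative. *)
Lemma moving_class w a m nu : (size w <= (size nu).+1)%N ->
  \sum_(r <- moving F w | (r.1.1.2 == (a, m - 1)) && perm_eq (r.1.2 ++ r.2) nu) r.1.1.1 =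
    if perm_eq w ((a.+1, m) :: nu)
    then (- ((a.+2)%:R *: 'X + m%:~R%:P)) *+ count_mem (a.+1, m) w else 0 :> {poly F}.
Proof.
move=> hw; rewrite /moving big_flatten big_map -count_splits [RHS]big_mkcond /=.
rewrite big_seq [RHS]big_seq; apply: eq_bigr => -[[p [[|a'] m']] s] /splits_cat_cons /= wE.
  rewrite big_map big_seq_cond big_pred0 // => -[[p' [b m1]] s'] /=.
  apply/negbTE/negP => /andP[/splits_cat_cons /= sE /andP[_ /perm_size]].
  by move: hw; rewrite wE sE !size_cat /= !size_cat /=; lia.
rewrite big_mkcond big_seq1 /= !xpair_eqE eqSS.
have -> : (m' - 1 == m - 1) = (m' == m) by lia.
by case: eqP => //= ->; case: eqP => //= ->.
Qed.

Lemma fixed_class w m nu (c : F) :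
  \sum_(r <- fixed w | (r.1 == m) && perm_eq r.2 nu) c =
    if perm_eq w ((0%N, m) :: nu) then c *+ count_mem (0%N, m) w else 0.
Proof.
rewrite /fixed big_flatten big_map -count_splits [RHS]big_mkcond /=.
apply: eq_bigr => -[[p [[|a'] m']] s] _ /=; last by rewrite big_nil.
by rewrite big_mkcond big_seq1.
Qed.

Lemma cf_count u l nu (W : lmodType F) (q : W) :
  \sum_(t <- u) t.1 *: (if perm_eq t.2 (l :: nu) then q *+ count_mem l t.2 else 0) =
    cf u (l :: nu) *: (q *+ (count_mem l nu).+1).
Proof.
rewrite /cf scaler_suml [RHS]big_mkcond; apply: eq_bigr => t _.
case: ifP => [/permP ->|_]; last by rewrite scaler0.
by rewrite /= eqxx.
Qed.

(** The relation is a Laurent polynomial annihilated by [phi]; multiplying by [t^B] makes it a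
    polynomial, nonzero by its coefficient coming from [m]. *)
Lemma recurrent_of_sum (s : seq (F * int)) (m : int) :
  (forall k, \sum_(r <- s) r.1 * phi Lam (k + r.2) = 0) ->
  \sum_(r <- s | r.2 == m) r.1 != 0 -> recurrent Lam.
Proof.
move=> hs hm.
have [B hB] := bounded_letters [seq (0%N, r.2) | r <- s].
have hB' r : r \in s -> r.2 = (absz (r.2 + B%:Z))%:Z - B%:Z.
  move=> rs; have /= := hB (0%N, r.2) (map_f _ rs).
  by move: (r.2 : int) => z; lia.
pose P : {poly F} := \sum_(r <- s) r.1 *: 'X^(absz (r.2 + B%:Z)).
have mB : 0 <= m + B%:Z.
  apply: contraNT hm => mB; rewrite big_seq_cond big_pred0 // => r.
  apply/negbTE/negP => /andP[/hB' rE /eqP rm]; move: mB rE; rewrite rm; lia.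
have Pm : P`_(absz (m + B%:Z)) = \sum_(r <- s | r.2 == m) r.1.
  rewrite coef_sum [RHS]big_mkcond big_seq [RHS]big_seq; apply: eq_bigr => r /hB' rE.
  rewrite coefZ coefXn; have -> : (absz (m + B%:Z) == absz (r.2 + B%:Z)) = (r.2 == m).
    by move: (r.2 : int) rE => z; lia.
  by case: ifP => _; rewrite ?mulr1 ?mulr0.
exists P; split; first by apply: contraNneq hm => PE; rewrite -Pm PE coef0.
move=> k; rewrite -/(dot (phi Lam : int -> F^o) k P) linear_sum -[RHS](hs (k + B%:Z)).
rewrite big_seq [RHS]big_seq; apply: eq_bigr => r /hB' rE.
rewrite linearZZ /= dotXn; congr (_ * phi _ _).
by move: (r.2 : int) rE => z; lia.
Qed.

Lemma size_le_wt (u : seq (F * word)) n : (forall t, t \in u -> wt t.2 = n) ->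
  forall t, t \in u -> (size t.2 <= n)%N.
Proof. by move=> hu t /hu <-; apply: size_wt. Qed.

(* The top-degree symbol, in the symmetric algebra of [B_-], of an element
   annihilating [v] is zero. *)
Lemma symbol_vanishes (nonrec : ~ recurrent Lam) n (u : seq (F * word)) L :
  (forall t, t \in u -> wt t.2 = n) -> ev rho u v = 0 ->
  (forall t, t \in u -> (size t.2 <= L)%N) -> forall mu, size mu = L -> cf u mu = 0.
Proof.
elim: n u L => [|n IH] u L hwt hev hL mu hmu.
  have nil t : t \in u -> t.2 = [::].
    by move=> /hwt h; apply: size0nil; apply/eqP; rewrite -leqn0 -h size_wt.
  case: mu hmu => [|x mu] _; last first.
    rewrite /cf big_seq_cond big_pred0 // => t.
    by apply/negbTE/negP => /andP[/nil -> /perm_size].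
  move: hev; rewrite /ev /cf big_seq (eq_bigr (fun t => t.1 *: v)) => [|t /nil -> //].
  rewrite -scaler_suml => /eqP; rewrite scaler_eq0 (negPf v0) orbF => /eqP h.
  rewrite -[RHS]h big_seq_cond; apply: eq_bigl => t.
  by case: (boolP (t \in u)) => //= /nil ->.
have hlow k := lower_wt (Lam := Lam) (k := k) hwt.
have hev' k : ev rho (lower Lam k u) v = 0 by rewrite ev_lower // hev linear0.
apply: contrapT => /eqP cf0.
have wtmu : wt mu = n.+1.
  have [t tu ht] : exists2 t, t \in u & perm_eq t.2 mu.
    apply: contrapT => h; case/eqP: cf0; rewrite /cf big_seq_cond big_pred0 // => t.
    by apply/negbTE/negP => /andP[tu ht]; apply: h; exists t.
  by rewrite -(hwt _ tu) /wt; apply: perm_sumn; rewrite perm_map // perm_sym.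
(* If [mu] has a letter of degree below -1, its moving terms keep length [L], with coefficient
   linear in [k] and leading coefficient a nonzero multiple of [cf u mu]. *)
have [/hasP[[[//|a] m] lmu _]|] := boolP (has (fun x => x.1 != 0%N) mu).
  pose l := (a.+1, m); pose nu := rem l mu.
  have munu : perm_eq mu (l :: nu) by apply: perm_to_rem.
  have hnu : (size nu).+1 = L by rewrite -hmu (perm_size munu).
  have cfE : cf u mu = cf u (l :: nu).
    by apply: eq_bigl => t; apply: (permPr munu).
  have [h1 _] := @moving_fixed_separate F charF0 _ _ L (fun k mu' hmu' =>
    etrans (esym (cf_lower k u mu')) (IH _ L (hlow k) (hev' k) (lower_size (k := k) hL) mu' hmu')).
  have := h1 (a, m - 1) nu hnu.
  rewrite big_map /movingu big_flatten big_map.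
  under eq_bigr => t _ do rewrite big_map /= -scaler_sumr.
  rewrite big_seq (eq_bigr (fun t => t.1 *: (if perm_eq t.2 (l :: nu)
    then (- ((a.+2)%:R *: 'X + m%:~R%:P)) *+ count_mem l t.2 else 0))) => [|t tu]; last first.
    by rewrite moving_class // hnu; apply: hL.
  rewrite -big_seq cf_count -cfE => /eqP; rewrite scaler_eq0 (negPf cf0) /=.
  move/eqP/(congr1 (fun q : {poly F} => q`_1)).
  rewrite coef0 coefMn coefN coefD coefZ coefX coefC mulr1 addr0 mulNrn => /eqP.
  by rewrite oppr_eq0 -mulrnA (pcharf0P F).1.
(* Now all letters have degree -1, so [mu] has length [n + 1], and contracting one letter with [phi]
   gives fixed terms of the maximal length [n]. *)
rewrite -all_predC => /allP mu1.
have muE : mu != [::] by apply: contra_eqN wtmu => /eqP ->.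
case: mu hmu cf0 wtmu mu1 muE => // -[a m] nu hmu cf0 wtmu mu1 _.
have a0 : a = 0%N by have := mu1 _ (mem_head _ _) => /=; rewrite negbK => /eqP.
have hnu : size nu = n.
  have all1 (w : word) : (forall x, x \in w -> x.1 = 0%N) -> wt w = size w.
    elim: w => // x w IHw h; rewrite wt_cons h ?mem_head // IHw // => y yw.
    by apply: h; rewrite inE yw orbT.
  have /all1 : forall x, x \in (a, m) :: nu -> x.1 = 0%N.
    by move=> x /mu1 /=; rewrite negbK => /eqP.
  by rewrite wtmu => -[->].
have [_ h2] := @moving_fixed_separate F charF0 _ _ n (fun k mu' hmu' =>
    etrans (esym (cf_lower k u mu')) (IH _ n (hlow k) (hev' k) (size_le_wt (hlow k)) mu' hmu')).
apply: nonrec; apply: (@recurrent_of_sum [seq r.1 | r <- fixedu u & perm_eq r.2 nu] m).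
  by move=> k; rewrite -[RHS](h2 k nu hnu) !big_map big_filter.
rewrite big_map big_filter_cond /fixedu big_flatten big_map.
under eq_bigr => t _ do rewrite big_map /=.
have -> : \sum_(t <- u) \sum_(r <- fixed t.2 | perm_eq r.2 nu && (r.1 == m)) t.1 =
    \sum_(t <- u) t.1 *: (if perm_eq t.2 ((a, m) :: nu) then (1 : F^o) *+ count_mem (a, m) t.2 else 0).
  apply: eq_bigr => t _; under eq_bigl do rewrite andbC.
  rewrite fixed_class a0; case: ifP => _; last by rewrite scaler0.
  by rewrite -scalerMnr -[t.1 *: 1]/(t.1 * 1) mulr1.
rewrite cf_count -[_ *: _]/(_ * _) mulf_neq0 //.
by rewrite (pcharf0P F).1.
Qed.

End SymbolVanishing.

(** * The Verma module in the nonrecurrent case *)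

Section Straightening.
Variable F : fieldType.

(** Each transposition leaves a bracket of the same weight and one letter shorter; two letters of
    negative degree have no central term. *)
Lemma straighten (w w' : word) : perm_eq w w' -> exists r : seq (F * word),
  (forall t, t \in r -> wt t.2 = wt w /\ (size t.2 < size w)%N) /\
  forall (V : lmodType F) (rho : Bmod V) z, act rho w z = act rho w' z + ev rho r z.
Proof.
elim: w w' => [|x w IH] w' hw.
  exists [::]; split=> // V rho z; rewrite /ev big_nil addr0.
  by move: hw; rewrite perm_sym => /perm_nilP ->.
have xw' : x \in w' by rewrite -(perm_mem hw) mem_head.
case/splitPr: xw' hw => p s; rewrite perm_sym perm_eq_mid perm_cons perm_sym => hw.
have [r [hr er]] := IH _ hw.
exists ([seq (t.1, [:: x] ++ t.2) | t <- r] ++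
  [seq ((x.2 * - (t.1.2.1.+1)%:Z - - (x.1.+1)%:Z * t.1.2.2)%:~R,
        t.1.1 ++ ((x.1 + t.1.2.1).+1, x.2 + t.1.2.2 - 1) :: t.2 ++ s) | t <- splits p]).
have wtw : wt w = wt (p ++ s) by rewrite /wt; apply: perm_sumn; apply: perm_map.
split=> [t|V rho z].
  rewrite mem_cat => /orP[] /mapP[t0 ht0 ->] /=.
    by have [h1 h2] := hr _ ht0; rewrite !wt_cons h1 ltnS.
  have sw := perm_size hw; move: wtw sw; rewrite (splits_cat_cons ht0).
  rewrite !wt_cat !wt_cons !wt_cat !size_cat /= !size_cat /=; lia.
rewrite ev_cat ev_prefix !act_cons er linearD act_nil [RHS]addrA [RHS]addrAC; congr (_ + _).
rewrite !act_cat act_cons (@act_commutator _ _ rho (Y rho x)); congr (_ + _).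
rewrite /ev big_map; apply: eq_bigr => t _ /=.
have nC : (- (x.1.+1)%:Z == - - (t.1.2.1.+1)%:Z) = false by lia.
rewrite /Y X_commutator nC addr0 linearZZ !act_cat act_cons act_cat /Y /=; congr (_ *: act _ _ (X _ _ _ _)); lia.
Qed.

Definition class_repr (w : word) : word := choose (perm_eq w) w.

Lemma class_reprP w : perm_eq w (class_repr w).
Proof. exact: chooseP. Qed.

Lemma class_repr_eq w w' : (class_repr w == class_repr w') = perm_eq w w'.
Proof.
apply/eqP/idP => [e|h].
  by rewrite (perm_trans (class_reprP w)) // e perm_sym class_reprP.
rewrite /class_repr (@eq_choose _ (perm_eq w) (perm_eq w')) => [|s]; last exact: (permPl h).
by apply: choose_id; rewrite // perm_sym.
Qed.

(** Replace the words of length [L] by class representatives: their total coefficients are values of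
    [cf], so only the shorter corrections remain. *)
Lemma reduce_symbol (u : seq (F * word)) n L :
  (forall t, t \in u -> wt t.2 = n) -> (forall t, t \in u -> (size t.2 <= L)%N) ->
  (forall mu, size mu = L -> cf u mu = 0) ->
  exists u' : seq (F * word),
    [/\ forall t, t \in u' -> wt t.2 = n, forall t, t \in u' -> (size t.2 < L)%N
      & forall (V : lmodType F) (rho : Bmod V) z, ev rho u z = ev rho u' z].
Proof.
move=> hwt hL hcf.
have [R hR] := choice (fun w => straighten (class_reprP w)).
pose top := [seq t <- u | size t.2 == L].
exists ([seq t <- u | size t.2 != L] ++
  flatten [seq [seq (t.1 * r.1, r.2) | r <- R t.2] | t <- top]); split.
- move=> t; rewrite mem_cat mem_filter => /orP[/andP[_ /hwt//]|].
  case/flatten_mapP => t0; rewrite mem_filter => /andP[_ /hwt <-] /mapP[r rR ->] /=.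
  by have [h _] := hR t0.2; case: (h _ rR).
- move=> t; rewrite mem_cat mem_filter => /orP[/andP[sL /hL]|].
    by rewrite leq_eqVlt (negPf sL).
  case/flatten_mapP => t0; rewrite mem_filter => /andP[/eqP <- _] /mapP[r rR ->] /=.
  by have [h _] := hR t0.2; case: (h _ rR).
move=> V rho z; rewrite ev_cat ev_flatten.
under eq_bigr => t _ do rewrite ev_scale.
rewrite {1}/ev (bigID (fun t : F * word => size t.2 == L)) /= addrC /ev big_filter.
congr (_ + _); rewrite -big_filter -/top.
have -> : \sum_(t <- top) t.1 *: act rho t.2 z = \sum_(t <- top) t.1 *: act rho (class_repr t.2) z
    + \sum_(t <- top) t.1 *: ev rho (R t.2) z.
  rewrite -big_split; apply: eq_bigr => t _ /=; rewrite -scalerDr.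
  by have [_ ->] := hR t.2.
rewrite (sum_by_key (fun t : F * word => class_repr t.2)) big_seq big1 ?add0r // => y.
rewrite mem_undup => /mapP[t0 t0top ->].
have sz0 : size t0.2 = L by move: t0top; rewrite mem_filter => /andP[/eqP].
rewrite (eq_bigr (fun t => t.1 *: act rho (class_repr t0.2) z)) => [|t /eqP -> //].
rewrite -scaler_suml -[RHS](scale0r (act rho (class_repr t0.2) z)); congr (_ *: _).
rewrite -[RHS](hcf _ sz0) /top big_filter_cond; apply: eq_bigl => t.
rewrite class_repr_eq; case hp: (perm_eq _ _); rewrite ?andbF // andbT.
by rewrite (perm_size hp) sz0 eqxx.
Qed.

End Straightening.

Section Nonrecurrent.
Variables (F : fieldType) (charF0 : [pchar F] =i pred0) (V : lmodType F) (rho : Bmod V).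
Variables (Lam : weight F) (v : V).
Hypotheses (hv : hw_vector rho Lam v) (v0 : v != 0) (nonrec : ~ recurrent Lam).

(** Alternating [symbol_vanishes] and [reduce_symbol] shortens [u] until nothing is left; the
    rewriting does not depend on the module. *)
Lemma annihilator_universal_homog (u : seq (F * word)) n L :
  (forall t, t \in u -> wt t.2 = n) -> (forall t, t \in u -> (size t.2 < L)%N) ->
  ev rho u v = 0 -> forall (W : lmodType F) (sigma : Bmod W) z, ev sigma u z = 0.
Proof.
elim: L u => [|L IH] u hwt hL hev W sigma z.
  by rewrite /ev big_seq big_pred0 // => t; apply/negbTE/negP => /hL.
have [u' [hwt' hL' e]] := reduce_symbol hwt hL (symbol_vanishes charF0 hv v0 nonrec hwt hev hL).
by rewrite e; apply: IH => //; rewrite -e.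
Qed.

Lemma annihilator_universal u : ev rho u v = 0 ->
  forall (W : lmodType F) (sigma : Bmod W) z, ev sigma u z = 0.
Proof.
move=> hev W sigma z; rewrite ev_homog big1 // => n _.
have hwt t : t \in homog n u -> wt t.2 = n by rewrite mem_filter => /andP[/eqP].
apply: (annihilator_universal_homog hwt (L := n.+1)); last exact: (ev_homog_eq0 charF0 hv hev).
by move=> t /hwt <-; rewrite ltnS size_wt.
Qed.

Hypothesis gen : generates rho v.

(** Sending [ev rho u v] to [ev sigma u w] is well defined by [annihilator_universal], and is a
    homomorphism because expansions are the same in all modules. *)
Lemma nonrecurrent_Verma : is_Verma rho Lam v.
Proof.
split=> // W sigma w hw; split; last first.
  move=> f g [lf fL fC] [lg gL gC] fv gv; apply: gen; last by rewrite fv gv.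
  have f0 : f 0 = 0 by have := lf (-1) 0 0; rewrite scaler0 addr0 scaleN1r addNr.
  have g0 : g 0 = 0 by have := lg (-1) 0 0; rewrite scaler0 addr0 scaleN1r addNr.
  split; first split.
  - by rewrite f0 g0.
  - by move=> x y fx fy; rewrite -[x]scale1r lf lg fx fy.
  - by move=> a x fx; rewrite -[a *: x]addr0 lf lg fx f0 g0.
  - by move=> i j x fx; rewrite fL gL fx.
  - by move=> x fx; rewrite fC gC fx.
have [U hU] := choice (ev_onto hv gen).
have wd u u' : ev rho u v = ev rho u' v -> ev sigma u w = ev sigma u' w.
  move=> e; have := @annihilator_universal (u ++ [seq (-1 * t.1, t.2) | t <- u']) _ W sigma w.
  rewrite !ev_cat !ev_scale !scaleN1r e subrr => /(_ erefl) /eqP.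
  by rewrite subr_eq0 => /eqP.
exists (fun x => ev sigma (U x) w); split; last first.
  by rewrite (wd _ [:: (1, [::])]) -?hU /ev big_seq1 ?scale1r.
split=> [a x y|i j x|x].
- rewrite -ev_scale -ev_cat; apply: wd.
  by rewrite ev_cat ev_scale -!hU.
- have [u hu] := X_ev_expansion Lam i (j + 1) (U x).
  have XL (M : lmodType F) (tau : Bmod M) y : Lop tau i j y = X tau i (j + 1) y by rewrite /X addrK.
  by rewrite (XL W) hu //; apply: wd; rewrite -hu // -XL -!hU.
- rewrite (Cop_ev _ hw) -ev_scale; apply: wd.
  by rewrite -hU ev_scale -(Cop_ev _ hv) -hU.
Qed.

End Nonrecurrent.

(** * Equivalence of the three conditions *)

Lemma proper_quotient_recurrent (F : fieldType) (charF0 : [pchar F] =i pred0)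
  (V : lmodType F) (rho : Bmod V) (Lam : weight F) (v : V) :
  irreducible rho -> hw_vector rho Lam v -> generates rho v ->
  proper_Verma_quotient rho Lam -> recurrent Lam.
Proof.
move=> Hirr hv gen hq; apply: contrapT => nonrec.
have v0 := hw_neq0 Hirr hv gen.
have [f [[lf fL fC] fonto [x [x0 fx]]]] := hq _ _ _ (nonrecurrent_Verma charF0 hv v0 nonrec gen).
have f0 : f 0 = 0 by have := lf (-1) 0 0; rewrite scaler0 addr0 scaleN1r addNr.
have hker : submodule rho (fun y => f y = 0).
  split; first split=> // [y z hy hz|a y hy].
  - by rewrite -[y]scale1r lf hy hz scaler0 addr0.
  - by rewrite -[a *: y]addr0 lf hy f0 scaler0 addr0.
  - by move=> i j y hy; rewrite fL hy linear0.
  - by move=> y hy; rewrite fC hy linear0.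
case: Hirr => _ /(_ _ hker) [h|h].
  by move/eqP: x0; apply; apply: h.
by have [y yv] := fonto v; rewrite -yv h eqxx in v0.
Qed.

Theorem theorem1p1 (F : fieldType) (charF0 : [pchar F] =i pred0)
  (V : lmodType F) (rho : Bmod V) (Lam : weight F)
  (Hirr : irreducible rho) (Hhw : is_hw_module rho Lam) :
  (quasifinite rho <-> proper_Verma_quotient rho Lam) /\
  (proper_Verma_quotient rho Lam <-> cond3 Lam).
Proof.
have [v [hv gen]] := Hhw.
have q_rec : quasifinite rho <-> recurrent Lam.
  split=> [hq|/recurrent_dot [P P0 hP]].
    exact: (quasifinite_recurrent hv (hw_neq0 Hirr hv gen) hq).
  exact: (recurrent_quasifinite charF0 hv P0 (recurrent_singular charF0 Hirr hv gen hP) gen).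
have p_rec : proper_Verma_quotient rho Lam <-> recurrent Lam.
  split; first exact: (proper_quotient_recurrent charF0 Hirr hv gen).
  exact: (recurrent_proper_quotient charF0 Hirr hv gen).
by rewrite q_rec p_rec cond3_recurrent.
Qed.
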